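(* Let $A$ be a unital separable C*-algebra, $\alpha$ a *-automorphism of $A$, and $\{n_k\}_{k\ge 1}$ an increasing sequence of positive integers with $n_k\mid n_{k+1}$ for all $k$ and $n_1=1$. Let $X=\prod_{i=1}^\infty\{0,1,\dots,m_i-1\}$ with $m_i=n_{i+1}/n_i$, let $\sigma_0:X\to X$ be the odometer homeomorphism, and let $\sigma$ be the automorphism of $C(X,A)$ given by $\sigma(f)(x)=\alpha(f(\sigma_0^{-1}(x)))$. Then the algebra $\mathcal{B}_\alpha(\{n_k\})$ is *-isomorphic to the crossed product $C(X,A)\times_\sigma\mathbb{Z}$.
   Context: For $n\ge 1$, $A\times_{\alpha^n}\mathbb{Z}$ denotes the crossed product C*-algebra, generated by $A$ and a unitary $u_n$ with $u_n a u_n^*=\alpha^n(a)$ for $a\in A$. Put $\mathcal{B}_\alpha(n)=M_n(A\times_{\alpha^n}\mathbb{Z})$, with matrix units $e_{i,j}$, $0\le i,j\le n-1$. If $n\mid m$ and $k=m/n$, let $\gamma_{n,m}:\mathcal{B}_\alpha(n)\to\mathcal{B}_\alpha(m)$ be the injective unital *-homomorphism determined by $\gamma_{n,m}(ae_{0,0})=\sum_{l=0}^{k-1}\alpha^{ln}(a)e_{ln,ln}$ for $a\in A$, $\gamma_{n,m}(u_ne_{0,0})=u_me_{(k-1)n,0}+\sum_{l=0}^{k-2}e_{ln,(l+1)n}$, and $\gamma_{n,m}(e_{i,j})=\sum_{l=0}^{k-1}e_{i+ln,j+ln}$ for $0\le i,j\le n-1$. The Bunce-Deddens algebra of $\alpha$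 is the C*-algebraic direct limit $\mathcal{B}_\alpha(\{n_k\})=\varinjlim(\mathcal{B}_\alpha(n_k),\gamma_{n_k,n_{k+1}})$. Odometer: $X$ has the product topology (each factor discrete). For $x=(x_i)\in X$ let $i(x)$ be the smallest $i$ with $x_i<m_i-1$ ($i(x)=\infty$ if there is none). If $i(x)<\infty$, then $\sigma_0(x)_i=0$ for $i<i(x)$, $\sigma_0(x)_{i(x)}=x_{i(x)}+1$, and $\sigma_0(x)_i=x_i$ for $i>i(x)$; if $i(x)=\infty$, $\sigma_0(x)=(0,0,\dots)$. This is a homeomorphism of $X$. $C(X,A)$ is the C*-algebra of continuous functions from $X$ to $A$. *)

(* Defs.v *)
From HB Require Import structures.
From mathcomp Require Import all_boot all_order all_algebra.
From mathcomp Require Import complex.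
From mathcomp Require Import boolp classical_sets functions cardinality.
From mathcomp Require Import reals topology normedtype.

Set Implicit Arguments.
Unset Strict Implicit.
Unset Printing Implicit Defensive.

Import Order.TTheory GRing.Theory Num.Theory.
Import numFieldNormedType.Exports.

Local Open Scope classical_set_scope.
Local Open Scope ring_scope.

(* Unital C*-algebras over the complex numbers [R[i]]; [algType] includes
   [1 != 0], so the zero algebra is excluded throughout.  The norm is a
   real-valued operation of its own because the only join of rings
   and normed Z-modules in the hierarchy is [numDomainType]. *)
HB.mixin Record isCStarAlgebra (R : realType) A & GRing.Algebra R[i] A := {
  star : A -> A;
  starK : involutive star;
  starD : forall x y : A, star (x + y) = star x + star y;
  starZ : forall (c : R[i]) (x : A), star (c *: x) = c^* *: star x;
  starM : forall x y : A, star (x * y) = star y * star x;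
  cnorm : A -> R;
  cnorm0_eq0 : forall x : A, cnorm x = 0 -> x = 0;
  cnormD : forall x y : A, cnorm (x + y) <= cnorm x + cnorm y;
  cnormZ : forall (c : R[i]) (x : A),
    cnorm (c *: x) = ComplexField.Normc.normc c * cnorm x;
  cnormM : forall x y : A, cnorm (x * y) <= cnorm x * cnorm y;
  cnorm_starM : forall x : A, cnorm (star x * x) = cnorm x ^+ 2;
  cnorm_complete : forall a : nat -> A,
    (forall e : R, 0 < e -> exists N, forall p q, (N <= p)%N -> (N <= q)%N ->
       cnorm (a p - a q) < e) ->
    exists l : A, forall e : R, 0 < e -> exists N, forall p, (N <= p)%N ->
       cnorm (a p - l) < e
}.

#[short(type="cstarAlgType")]
HB.structure Definition CStarAlgebra (R : realType) :=
  {A of GRing.Algebra R[i] A & isCStarAlgebra R A}.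

HB.mixin Record isStarPreserving (R : realType) (A B : cstarAlgType R)
    (f : A -> B) := {
  starhom_star : forall x, f (star x) = star (f x)
}.

HB.structure Definition StarHom (R : realType) (A B : cstarAlgType R) :=
  {f of @GRing.LRMorphism R[i] A B *:%R f & isStarPreserving R A B f}.

Notation "{ 'starhom' A -> B }" := (StarHom.type A B)
  (at level 0, A at level 98, B at level 99,
   format "{ 'starhom'  A  ->  B }") : type_scope.

Section CStarTheory.
Context {R : realType}.

Section Norm.
Context {A : cstarAlgType R}.
Implicit Types x y : A.

Lemma cnorm0 : cnorm (0 : A) = 0.
Proof. by rewrite -(scale0r 1) cnormZ ComplexField.Normc.normc0 mul0r. Qed.

Lemma cnormN x : cnorm (- x) = cnorm x.
Proof.
rewrite -scaleN1r cnormZ.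
suff -> : ComplexField.Normc.normc (-1 : R[i]) = 1 by rewrite mul1r.
by rewrite /= oppr0 sqrrN expr1n expr0n addr0 sqrtr1.
Qed.

Lemma cnormB x y : cnorm (x - y) = cnorm (y - x).
Proof. by rewrite -cnormN opprB. Qed.

Lemma cnorm_ge0 x : 0 <= cnorm x.
Proof.
have := cnormD x (- x); rewrite subrr cnorm0 cnormN -mulr2n.
by rewrite pmulrn_lge0.
Qed.

Lemma star0 : star 0 = 0 :> A.
Proof. by apply: (addrI (star 0)); rewrite -starD !addr0. Qed.

Lemma starN x : star (- x) = - star x.
Proof. by rewrite -scaleN1r starZ rmorphN1 scaleN1r. Qed.

Lemma starB x y : star (x - y) = star x - star y.
Proof. by rewrite starD starN. Qed.

Lemma cnorm_star x : cnorm (star x) = cnorm x.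
Proof.
have le y : cnorm y <= cnorm (star y).
  have [->|y0] := eqVneq (cnorm y) 0; first exact: cnorm_ge0.
  have y_gt0 : 0 < cnorm y by rewrite lt_neqAle eq_sym y0 cnorm_ge0.
  by rewrite -(ler_pM2r y_gt0) -expr2 -cnorm_starM cnormM.
by apply/eqP; rewrite eq_le le andbT -{2}(starK x) le.
Qed.

Lemma cnorm_dist_le x y : `|cnorm x - cnorm y| <= cnorm (x - y).
Proof.
have le u v : cnorm u - cnorm v <= cnorm (u - v).
  by rewrite lerBlDr -{1}(subrK v u) cnormD.
by rewrite ler_norml le andbT lerNl opprB cnormB le.
Qed.

End Norm.

Definition cnorm_dense (A : cstarAlgType R) (S : set A) :=
  forall (x : A) (e : R), 0 < e -> exists2 s, S s & cnorm (x - s) < e.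

Definition cnorm_closed (A : cstarAlgType R) (S : set A) :=
  forall x : A, (forall e : R, 0 < e -> exists2 s, S s & cnorm (x - s) < e) ->
  S x.

Definition cseparable (A : cstarAlgType R) :=
  exists2 S : set A, countable S & cnorm_dense S.

Definition unitary (A : cstarAlgType R) (u : A) :=
  star u * u = 1 /\ u * star u = 1.

Definition star_isomorphic (A B : cstarAlgType R) :=
  exists f : {starhom A -> B}, bijective f.

Definition star_subalgebra (A : cstarAlgType R) (S : set A) :=
  [/\ S 1, forall x y, S x -> S y -> S (x + y),
      forall (c : R[i]) x, S x -> S (c *: x),
      forall x y, S x -> S y -> S (x * y) & forall x, S x -> S (star x)].

(* [B] is generated, as a C*-algebra, by the image of [iota] and [u]. *)
Definition generated_by (A B : cstarAlgType R) (iota : A -> B) (u : B) :=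
  forall S : set B, star_subalgebra S -> cnorm_closed S ->
  (forall a, S (iota a)) -> S u -> S = setT.

Definition covariant (A B : cstarAlgType R) (alpha : A -> A) (iota : A -> B)
    (u : B) :=
  unitary u /\ forall a, u * iota a * star u = iota (alpha a).

(* [(B, iota, u)] is the crossed product of [A] by the action of the integers
   generated by [alpha]: the universal C*-algebra generated by a copy of [A] and
   a unitary [u] implementing [alpha]. *)
Definition is_crossed_product (A : cstarAlgType R) (alpha : A -> A)
    (B : cstarAlgType R) (iota : {starhom A -> B}) (u : B) :=
  [/\ covariant alpha iota u, generated_by iota u &
      forall (D : cstarAlgType R) (pi : {starhom A -> D}) (v : D),
        covariant alpha pi v ->
        exists2 phi : {starhom B -> D}, forall a, phi (iota a) = pi a & phi u = v].

(* A *-algebra carries at most one complete C*-norm, so the C*-algebra of n x n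
   matrices over [E] is a C*-algebra [B] together with an isomorphism of
   complex *-algebras [Phi] from the matrices onto it. *)
Definition is_matrix_algebra (n : nat) (E B : cstarAlgType R)
    (Phi : {rmorphism 'M[E]_n -> B}) :=
  [/\ bijective Phi,
      forall (c : R[i]) M, Phi (map_mx ( *:%R c) M) = c *: Phi M &
      forall M, Phi (map_mx star M^T) = star (Phi M)].

Definition is_direct_limit (B : nat -> cstarAlgType R)
    (g : forall k, {starhom B k -> B k.+1}) (L : cstarAlgType R)
    (mu : forall k, {starhom B k -> L}) :=
  (forall k b, mu k.+1 (g k b) = mu k b) /\
  forall (D : cstarAlgType R) (nu : forall k, {starhom B k -> D}),
    (forall k b, nu k.+1 (g k b) = nu k b) ->
    exists phi : {starhom L -> D}, (forall k b, phi (mu k b) = nu k b) /\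
      forall psi : {starhom L -> D}, (forall k b, psi (mu k b) = nu k b) ->
      psi =1 phi.

(* The matrix with entry [x] at position [(i, j)] and zero elsewhere. *)
Definition mx_elem (E : cstarAlgType R) (n : nat) (i j : nat) (x : E) :
    'M[E]_n :=
  \matrix_(p, q) if (p == i :> nat) && (q == j :> nat) then x else 0.
Arguments mx_elem {E} n i j x.

(* [gamma] is the map from M_n of the crossed product [E] by [alpha^n] to M_m of
   the crossed product [E'] by [alpha^m], for [n] dividing [m], where the matrix
   algebras are the C*-algebras [B] and [B'], identified via [Phi], [Phi']. *)
Definition is_connecting_map (A : cstarAlgType R) (alpha : A -> A) (n m : nat)
    (E : cstarAlgType R) (iota : A -> E) (u : E)
    (E' : cstarAlgType R) (iota' : A -> E') (u' : E')
    (B : cstarAlgType R) (Phi : 'M[E]_n -> B)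
    (B' : cstarAlgType R) (Phi' : 'M[E']_m -> B')
    (gamma : B -> B') :=
  let k := (m %/ n)%N in
  [/\ injective gamma,
      forall a, gamma (Phi (mx_elem n 0%N 0%N (iota a))) =
        Phi' (\sum_(l < k)
                mx_elem m (l * n)%N (l * n)%N (iota' (iter (l * n)%N alpha a))),
      gamma (Phi (mx_elem n 0%N 0%N u)) =
        Phi' (mx_elem m (k.-1 * n)%N 0%N u' +
              \sum_(l < k.-1) mx_elem m (l * n)%N (l.+1 * n)%N 1) &
      forall i j, (i < n)%N -> (j < n)%N ->
        gamma (Phi (mx_elem n i j 1)) =
          Phi' (\sum_(l < k) mx_elem m (i + l * n)%N (j + l * n)%N 1)].

(* [L] is the Bunce-Deddens algebra of [alpha] and the sequence [n]. *)
Definition is_bunce_deddens (A : cstarAlgType R) (alpha : A -> A)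
    (n : nat -> nat) (L : cstarAlgType R) :=
  exists (E : nat -> cstarAlgType R) (iota : forall k, {starhom A -> E k})
    (u : forall k, E k)
    (B : nat -> cstarAlgType R) (Phi : forall k, {rmorphism 'M[E k]_(n k) -> B k})
    (gamma : forall k, {starhom B k -> B k.+1}) (mu : forall k, {starhom B k -> L}),
  [/\ forall k, is_crossed_product (iter (n k) alpha) (iota k) (u k),
      forall k, is_matrix_algebra (Phi k),
      forall k, is_connecting_map alpha (iota k) (u k) (iota k.+1) (u k.+1)
                  (Phi k) (Phi k.+1) (gamma k) &
      is_direct_limit gamma mu].

End CStarTheory.

HB.mixin Record isCompactSpace T & PointedTopological T := {
  compact_setT : compact [set: T]
}.

#[short(type="pcompactType")]
HB.structure Definition PointedCompact :=
  {T of PointedTopological T & isCompactSpace T}.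

(* [Cfun X A] is the C*-algebra C(X, A) for the norm topology on [A]; [X] is
   nonempty, so that C(X, A) is not the zero algebra. *)
Definition cnorm_continuous (R : realType) (X : topologicalType)
    (A : cstarAlgType R) (f : X -> A) :=
  forall (x : X) (e : R), 0 < e -> \forall y \near x, cnorm (f y - f x) < e.

Record Cfun (R : realType) (X : pcompactType) (A : cstarAlgType R) :=
  MkCfun { cfun :> X -> A; cfun_continuous : cnorm_continuous cfun }.

Section ContinuousFunctions.
Context {R : realType} {X : pcompactType} {A : cstarAlgType R}.
Local Notation C := (Cfun X A).
Implicit Types f g h : C.

HB.instance Definition _ := gen_eqMixin C.
HB.instance Definition _ := gen_choiceMixin C.

Lemma cfunE f g : f =1 g -> f = g.
Proof.
case: f g => [f fc] [g gc] /= /funext fg; rewrite fg in fc *.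
by congr MkCfun; exact: Prop_irrelevance.
Qed.

Fact cst_cont (a : A) : cnorm_continuous (fun _ : X => a).
Proof. by move=> x e e0; near=> y; rewrite subrr cnorm0.
Unshelve. all: by end_near. Qed.

Fact add_cont f g : cnorm_continuous (fun x => f x + g x).
Proof.
move=> x e e0; near=> y; rewrite opprD addrACA (le_lt_trans (cnormD _ _))//.
rewrite (splitr e) ltrD//; near: y; apply: cfun_continuous; exact: divr_gt0.
Unshelve. all: by end_near. Qed.

Fact opp_cont f : cnorm_continuous (fun x => - f x).
Proof.
move=> x e e0; near=> y; rewrite -opprD cnormN; near: y.
exact: cfun_continuous.
Unshelve. all: by end_near. Qed.

Fact star_cont f : cnorm_continuous (fun x => star (f x)).
Proof.
move=> x e e0; near=> y; rewrite -starB cnorm_star; near: y.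
exact: cfun_continuous.
Unshelve. all: by end_near. Qed.

Fact mul_cont f g : cnorm_continuous (fun x => f x * g x).
Proof.
move=> x e e0; set M := 1 + cnorm (f x) + cnorm (g x).
have M0 : 0 < M by rewrite ltr_pwDl ?ltr_pwDl ?cnorm_ge0.
pose d := Num.min 1 (e / 2 / M).
have d0 : 0 < d by rewrite lt_min ltr01 !divr_gt0.
near=> y.
have fd : cnorm (f y - f x) < d by near: y; exact: cfun_continuous.
have gd : cnorm (g y - g x) < d by near: y; exact: cfun_continuous.
have -> : f y * g y - f x * g x = f y * (g y - g x) + (f y - f x) * g x.
  by rewrite mulrBr mulrBl addrA subrK.
rewrite (le_lt_trans (cnormD _ _))// (splitr e).
have dM : d * M <= e / 2.
  by rewrite -ler_pdivlMr// /d ge_min lexx orbT.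
have fyM : cnorm (f y) <= M.
  rewrite -(subrK (f x) (f y)) (le_trans (cnormD _ _))//.
  rewrite (@le_trans _ _ (1 + cnorm (f x)))//; last first.
    by rewrite lerDl cnorm_ge0.
  by rewrite lerD2r ltW// (lt_le_trans fd)// ge_min lexx.
have gxM : cnorm (g x) <= M.
  by rewrite lerDr addr_ge0 ?cnorm_ge0.
apply: ltr_leD.
  apply: (le_lt_trans (cnormM _ _)); apply: lt_le_trans dM.
  rewrite mulrC (@le_lt_trans _ _ (cnorm (g y - g x) * M))//.
    by rewrite ler_wpM2l ?cnorm_ge0.
  by rewrite ltr_pM2r.
apply: (le_trans (cnormM _ _)); apply: le_trans dM.
by rewrite ler_pM ?cnorm_ge0// ltW.
Unshelve. all: by end_near. Qed.

Fact scale_cont (c : R[i]) f : cnorm_continuous (fun x => c *: f x).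
Proof.
move=> x e e0; have := mul_cont (MkCfun (cst_cont (c *: 1))) f.
move=> /(_ x e e0) /=; apply: filterS => y.
by rewrite -!scalerAl !mul1r.
Qed.

Definition cfun_cst a : C := MkCfun (cst_cont a).
Definition cfun_add f g : C := MkCfun (@add_cont f g).
Definition cfun_opp f : C := MkCfun (@opp_cont f).
Definition cfun_mul f g : C := MkCfun (@mul_cont f g).
Definition cfun_scale c f : C := MkCfun (@scale_cont c f).
Definition cfun_star f : C := MkCfun (@star_cont f).

Fact cfun_addA : associative cfun_add.
Proof. by move=> f g h; apply: cfunE => x /=; rewrite addrA. Qed.
Fact cfun_addC : commutative cfun_add.
Proof. by move=> f g; apply: cfunE => x /=; rewrite addrC. Qed.
Fact cfun_add0 : left_id (cfun_cst 0) cfun_add.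
Proof. by move=> f; apply: cfunE => x /=; rewrite add0r. Qed.
Fact cfun_addN : left_inverse (cfun_cst 0) cfun_opp cfun_add.
Proof. by move=> f; apply: cfunE => x /=; rewrite addNr. Qed.

HB.instance Definition _ := GRing.isZmodule.Build C
  cfun_addA cfun_addC cfun_add0 cfun_addN.

Fact cfun_mulA : associative cfun_mul.
Proof. by move=> f g h; apply: cfunE => x /=; rewrite mulrA. Qed.
Fact cfun_mul1l : left_id (cfun_cst 1) cfun_mul.
Proof. by move=> f; apply: cfunE => x /=; rewrite mul1r. Qed.
Fact cfun_mul1r : right_id (cfun_cst 1) cfun_mul.
Proof. by move=> f; apply: cfunE => x /=; rewrite mulr1. Qed.
Fact cfun_mulDl : left_distributive cfun_mul +%R.
Proof. by move=> f g h; apply: cfunE => x /=; rewrite mulrDl. Qed.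
Fact cfun_mulDr : right_distributive cfun_mul +%R.
Proof. by move=> f g h; apply: cfunE => x /=; rewrite mulrDr. Qed.
Fact cfun_1neq0 : cfun_cst 1 != 0.
Proof.
apply/eqP => /(congr1 (fun f : C => f point)) /= /eqP.
by rewrite oner_eq0.
Qed.

HB.instance Definition _ := GRing.Zmodule_isNzRing.Build C
  cfun_mulA cfun_mul1l cfun_mul1r cfun_mulDl cfun_mulDr cfun_1neq0.

Fact cfun_scaleA a b f : cfun_scale a (cfun_scale b f) = cfun_scale (a * b) f.
Proof. by apply: cfunE => x /=; rewrite scalerA. Qed.
Fact cfun_scale1 : left_id 1 cfun_scale.
Proof. by move=> f; apply: cfunE => x /=; rewrite scale1r. Qed.
Fact cfun_scaleDr : right_distributive cfun_scale +%R.
Proof. by move=> c f g; apply: cfunE => x /=; rewrite scalerDr. Qed.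
Fact cfun_scaleDl f : {morph cfun_scale^~ f : a b / a + b}.
Proof. by move=> a b; apply: cfunE => x /=; rewrite scalerDl. Qed.

HB.instance Definition _ := GRing.Zmodule_isLmodule.Build R[i] C
  cfun_scaleA cfun_scale1 cfun_scaleDr cfun_scaleDl.

Fact cfun_scaleAl (c : R[i]) f g : c *: (f * g) = (c *: f) * g.
Proof. by apply: cfunE => x /=; rewrite scalerAl. Qed.
Fact cfun_scaleAr (c : R[i]) f g : c *: (f * g) = f * (c *: g).
Proof. by apply: cfunE => x /=; rewrite scalerAr. Qed.

HB.instance Definition _ := GRing.Lmodule_isLalgebra.Build R[i] C cfun_scaleAl.
HB.instance Definition _ := GRing.Lalgebra_isAlgebra.Build R[i] C cfun_scaleAr.

Definition cfun_norm f : R := sup (range (fun x => cnorm (f x))).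

Fact cfun_has_sup f : has_sup (range (fun x => cnorm (f x))).
Proof.
split; first by exists (cnorm (f point)), point.
have nc : continuous (fun x => cnorm (f x)).
  move=> x; apply/cvgrPdist_lt => e e0; near=> y.
  rewrite distrC (le_lt_trans (cnorm_dist_le _ _))//.
  by near: y; exact: cfun_continuous.
have [M [_ HM]] := compact_bounded
  (continuous_compact (continuous_subspaceT nc) (@compact_setT X)).
exists (M + 1) => _ [x _ <-].
apply: le_trans (ler_norm _) _; apply: (HM (M + 1)); first by rewrite ltrDl.
by exists x.
Unshelve. all: by end_near. Qed.

Lemma cfun_norm_ge f x : cnorm (f x) <= cfun_norm f.
Proof. by apply: ub_le_sup; [case: (cfun_has_sup f)|exists x]. Qed.

Lemma cfun_norm_le f (M : R) : (forall x, cnorm (f x) <= M) -> cfun_norm f <= M.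
Proof.
move=> fM; apply: ge_sup; first by case: (cfun_has_sup f).
by move=> _ [x _ <-].
Qed.

Lemma cfun_norm_ge0 f : 0 <= cfun_norm f.
Proof. exact: le_trans (cnorm_ge0 _) (cfun_norm_ge f point). Qed.

Fact cfun_starK : involutive cfun_star.
Proof. by move=> f; apply: cfunE => x /=; rewrite starK. Qed.
Fact cfun_starD f g : cfun_star (f + g) = cfun_star f + cfun_star g.
Proof. by apply: cfunE => x /=; rewrite starD. Qed.
Fact cfun_starZ (c : R[i]) f : cfun_star (c *: f) = c^* *: cfun_star f.
Proof. by apply: cfunE => x /=; rewrite starZ. Qed.
Fact cfun_starM f g : cfun_star (f * g) = cfun_star g * cfun_star f.
Proof. by apply: cfunE => x /=; rewrite starM. Qed.

Fact cfun_norm0_eq0 f : cfun_norm f = 0 -> f = 0.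
Proof.
move=> f0; apply: cfunE => x; apply: cnorm0_eq0; apply/eqP.
by rewrite eq_le cnorm_ge0 andbT -f0 cfun_norm_ge.
Qed.

Fact cfun_normD f g : cfun_norm (f + g) <= cfun_norm f + cfun_norm g.
Proof.
apply: cfun_norm_le => x; apply: le_trans (cnormD _ _) _.
by rewrite lerD ?cfun_norm_ge.
Qed.

Fact cfun_normZ (c : R[i]) f :
  cfun_norm (c *: f) = ComplexField.Normc.normc c * cfun_norm f.
Proof.
have le (d : R[i]) g :
    cfun_norm (d *: g) <= ComplexField.Normc.normc d * cfun_norm g.
  apply: cfun_norm_le => x; rewrite cnormZ ler_wpM2l ?cfun_norm_ge//.
  by case: d => a b; exact: sqrtr_ge0.
apply/eqP; rewrite eq_le le /=.
have [->|c0] := eqVneq c 0.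
  by rewrite ComplexField.Normc.normc0 mul0r cfun_norm_ge0.
have := le c^-1 (c *: f).
rewrite scalerA mulVf// scale1r ComplexField.Normc.normcV.
rewrite mulrC ler_pdivlMr 1?mulrC//.
rewrite lt_neqAle eq_sym; apply/andP; split.
  by apply: contraNneq c0 => /ComplexField.Normc.eq0_normc ->.
by case: (c) => a b; exact: sqrtr_ge0.
Qed.

Fact cfun_normM f g : cfun_norm (f * g) <= cfun_norm f * cfun_norm g.
Proof.
apply: cfun_norm_le => x; apply: le_trans (cnormM _ _) _.
by rewrite ler_pM ?cfun_norm_ge ?cnorm_ge0.
Qed.

Fact cfun_norm_starM f : cfun_norm (cfun_star f * f) = cfun_norm f ^+ 2.
Proof.
apply/eqP; rewrite eq_le; apply/andP; split.
  apply: cfun_norm_le => x /=; rewrite cnorm_starM.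
  by rewrite ler_pXn2r ?nnegrE ?cnorm_ge0 ?cfun_norm_ge0 ?cfun_norm_ge.
rewrite -[leRHS]sqr_sqrtr ?cfun_norm_ge0//.
rewrite ler_pXn2r ?nnegrE ?sqrtr_ge0 ?cfun_norm_ge0//.
apply: cfun_norm_le => x.
rewrite -[leLHS]ger0_norm ?cnorm_ge0// -sqrtr_sqr ler_wsqrtr//.
rewrite -cnorm_starM; exact: (cfun_norm_ge (cfun_star f * f) x).
Qed.

Fact cfun_complete (a : nat -> C) :
  (forall e : R, 0 < e -> exists N, forall p q, (N <= p)%N -> (N <= q)%N ->
     cfun_norm (a p - a q) < e) ->
  exists l : C, forall e : R, 0 < e -> exists N, forall p, (N <= p)%N ->
     cfun_norm (a p - l) < e.
Proof.
move=> aC.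
have /choice[l lP] : forall x : X, exists l : A, forall e : R, 0 < e ->
    exists N, forall p, (N <= p)%N -> cnorm (a p x - l) < e.
  move=> x; apply: (cnorm_complete (fun p => a p x)) => e /aC[N HN].
  exists N => p q Np Nq; apply: le_lt_trans (HN p q Np Nq).
  exact: (cfun_norm_ge (a p - a q)).
have unif (e : R) : 0 < e -> exists N, forall p, (N <= p)%N ->
    forall x, cnorm (a p x - l x) <= e.
  move=> e0; have e20 : 0 < e / 2 by rewrite divr_gt0.
  have [N HN] := aC _ e20; exists N => p Np x.
  have [N' HN'] := lP x _ e20; pose q := maxn N N'.
  rewrite -(subrKA (a q x)) (le_trans (cnormD _ _))// (splitr e) lerD//.
    apply: le_trans (cfun_norm_ge (a p - a q) x) _.
    by rewrite ltW// HN// leq_maxl.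
  by rewrite ltW// HN'// leq_maxr.
have lc : cnorm_continuous l.
  move=> x e e0; have e40 : 0 < e / 2 / 2 by rewrite !divr_gt0.
  have [N /(_ N (leqnn N)) HN] := unif _ e40; near=> y.
  have -> : l y - l x = (l y - a N y) + (a N y - a N x) + (a N x - l x).
    by rewrite !subrKA.
  rewrite (le_lt_trans (cnormD _ _))// (splitr e) ltr_leD//.
    rewrite (le_lt_trans (cnormD _ _))// (splitr (e / 2)) ler_ltD//.
      by rewrite cnormB.
    by near: y; exact: cfun_continuous.
  by rewrite (le_trans (HN x))// ler_pdivrMr// ler_peMr ?ler1n// ltW// divr_gt0.
exists (MkCfun lc) => e e0; have e20 : 0 < e / 2 by rewrite divr_gt0.
have [N HN] := unif _ e20; exists N => p Np.
apply: (@le_lt_trans _ _ (e / 2)); first by apply: cfun_norm_le; exact: HN.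
by rewrite ltr_pdivrMr// ltr_pMr// ltr1n.
Unshelve. all: by end_near. Qed.

HB.instance Definition _ := isCStarAlgebra.Build R C
  cfun_starK cfun_starD cfun_starZ cfun_starM
  cfun_norm0_eq0 cfun_normD cfun_normZ cfun_normM cfun_norm_starM
  cfun_complete.

End ContinuousFunctions.

(* The i-th factor is {0, ..., m i - 1}; it is written ['I_(m i).-1.+1], which
   is ['I_(m i)] when [0 < m i], to make it nonempty for all [m]. *)
Definition odometer_space (m : nat -> nat) : Type :=
  prod_topology (fun i => discrete_topology 'I_(m i).-1.+1).

Section Odometer.
Context {m : nat -> nat}.
Local Notation X := (odometer_space m).

HB.instance Definition _ := Topological.copy X
  (prod_topology (fun i => discrete_topology 'I_(m i).-1.+1)).
HB.instance Definition _ := isPointed.Build X (fun=> ord0).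

Fact odometer_compact : compact [set: X].
Proof.
have := @tychonoff nat (fun i => discrete_topology 'I_(m i).-1.+1)
  (fun=> setT).
rewrite (_ : [set f | _] = setT); last by apply/seteqP; split.
apply=> i; apply: finite_compact; exact: finite_finset.
Qed.

HB.instance Definition _ := isCompactSpace.Build X odometer_compact.

(* [i(x)], with [None] for infinity *)
Definition carry_index (x : X) : option nat :=
  if pselect (exists i, (x i < (m i).-1)%N) is left ex
  then Some (ex_minn ex) else None.

Definition odometer (x : X) : X := fun i =>
  if carry_index x is Some j then
    if (i < j)%N then ord0 else if i == j then inord (x i).+1 else x i
  else ord0.

End Odometer.

(* Main.v *)
Require Import Defs.
From HB Require Import structures.
From mathcomp Require Import all_boot all_order all_algebra.
From mathcomp Require Import complex.
From mathcomp Require Import boolp classical_sets functions cardinality.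
From mathcomp Require Import reals topology normedtype sequences.
From mathcomp Require Import lra zify.

Set Implicit Arguments.
Unset Strict Implicit.
Unset Printing Implicit Defensive.

Import Order.TTheory GRing.Theory Num.Theory.
Import numFieldNormedType.Exports.

Local Open Scope classical_set_scope.
Local Open Scope ring_scope.

(* Put [p k] for the indicator of the clopen set of points whose first [k]
   digits vanish.  In the crossed product of C(X, A), the elements
   [u^-i (p k) u^j], for [i, j < n k], are matrix units commuting with the copy of
   [A x_(alpha^(n k)) Z] generated by the constant functions and [u^(n k)]; this
   gives compatible maps from the matrix algebras, hence a map from the direct
   limit.  Conversely, in the direct limit the unitary [v] coming from stage [0]
   shifts the matrix units of every stage, and [f |-> lim_k diag_i
   ((sigma^i f)(0))] represents C(X, A) covariantly with [v].  The two maps are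
   inverse to each other because they are so on generators, *-homomorphisms being
   continuous. *)

(** Crossed products and the direct limit enter only through their defining properties, so maps out
    of them are compared on generators or by the uniqueness clause of the limit. Comparison on
    generators needs *-homomorphisms to be bounded. A bound by 2 is drawn from the C*-identity: a
    self-adjoint [h] of norm at most 1/2 has a commuting self-adjoint [z] with [h^2 + z^2 = 1], an
    algebraic relation that survives in the image and caps the norm there.

    An off-diagonal unit [u^-i (p k) u^j] turns a constant [a] into [alpha^(j-i)(a)] when moved past
    it; strict commutation holds on the diagonal, in particular for the corner [p k]. Hence the
    matrix [x e_ij] is sent to [e_i0 phi(x) e_0j], which uses commutation with [e_00] alone. The
    same twist explains the sampling at 0: below level [k], [f] cut down to the support of
    [u^-i (p k) u^i] equals [u^-i c (p k) u^i], with [c] the constant [(sigma^i f)(0)]. *)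

Local Notation "r %:C" := (real_complex _ r) : ring_scope.

(** * Convergence in norm and continuity of *-homomorphisms *)

Section Convergence.
Context {R : realType}.

(** Convergence is phrased through the real sequence of norms, so that limit theorems for real
    sequences apply directly. *)
Definition ccvg (A : cstarAlgType R) (a : nat -> A) (l : A) :=
  (fun k => cnorm (a k - l)) @ \oo --> (0 : R).

Section Ccvg.
Context {A : cstarAlgType R}.
Implicit Types (a b : nat -> A) (l x y : A).

Lemma ccvgP a l : ccvg a l <-> forall e : R, 0 < e ->
  exists N, forall p, (N <= p)%N -> cnorm (a p - l) < e.
Proof.
split=> [al e e0|H].
  move/cvgrPdist_lt : al => /(_ e e0) [N _ HN]; exists N => p Np.
  by have := HN p Np; rewrite /= sub0r normrN ger0_norm ?cnorm_ge0.
apply/cvgrPdist_lt => e /H[N HN]; exists N => // p Np.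
by rewrite /= sub0r normrN ger0_norm ?cnorm_ge0// HN.
Qed.

Lemma ccvg_squeeze a l (b : nat -> R) :
  (forall k, cnorm (a k - l) <= b k) -> b @ \oo --> (0 : R) -> ccvg a l.
Proof.
move=> ab b0; apply: (squeeze_cvgr _ (cvg_cst 0) b0).
by apply: nearW => k; rewrite cnorm_ge0 ab.
Qed.

Lemma ccvg_eq a b l : a =1 b -> ccvg a l -> ccvg b l.
Proof. by move=> /funext ->. Qed.

Lemma ccvg_cst l : ccvg (fun=> l) l.
Proof. by rewrite /ccvg subrr cnorm0; exact: cvg_cst. Qed.

Lemma ccvgD a b x y : ccvg a x -> ccvg b y -> ccvg (fun k => a k + b k) (x + y).
Proof.
move=> ax /(cvgD ax); rewrite addr0; apply: ccvg_squeeze => k.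
by rewrite opprD addrACA cnormD.
Qed.

Lemma ccvgZ (c : R[i]) a x : ccvg a x -> ccvg (fun k => c *: a k) (c *: x).
Proof.
move=> /(cvgM (cvg_cst (ComplexField.Normc.normc c))).
rewrite mulr0 => ca0; apply: (ccvg_squeeze _ ca0) => k /=.
by rewrite -scalerBr cnormZ.
Qed.

Lemma ccvg_star a x : ccvg a x -> ccvg (fun k => star (a k)) (star x).
Proof. by apply: ccvg_squeeze => k; rewrite -starB cnorm_star. Qed.

Lemma ccvgM a b x y : ccvg a x -> ccvg b y -> ccvg (fun k => a k * b k) (x * y).
Proof.
move=> ax by_.
have ab0 : (fun k => cnorm (a k - x) * (cnorm (b k - y) + cnorm y) +
    cnorm x * cnorm (b k - y)) @ \oo --> (0 : R).
  have -> : 0 = 0 * (0 + cnorm y) + cnorm x * 0 :> R by rewrite mul0r mulr0 addr0.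
  apply: cvgD; apply: cvgM => //; last exact: cvg_cst.
  by apply: cvgD => //; exact: cvg_cst.
apply: (ccvg_squeeze _ ab0) => k /=.
have -> : a k * b k - x * y = (a k - x) * (b k - y + y) + x * (b k - y).
  by rewrite subrK mulrBl mulrBr addrA subrK.
rewrite (le_trans (cnormD _ _))// lerD ?cnormM//.
by rewrite (le_trans (cnormM _ _))// ler_wpM2l ?cnorm_ge0// cnormD.
Qed.

Lemma ccvg_unique a x y : ccvg a x -> ccvg a y -> x = y.
Proof.
move=> ax ay; apply/eqP; rewrite -subr_eq0; apply/eqP/cnorm0_eq0.
have H : (fun k => cnorm (a k - x) + cnorm (a k - y)) @ \oo --> (0 : R).
  by have -> : 0 = 0 + 0 :> R; [rewrite addr0 | exact: cvgD].
have : ccvg (fun=> x) y.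
  apply: (ccvg_squeeze _ H) => k /=.
  by rewrite -[x - y](subrKA (a k)) (le_trans (cnormD _ _))// cnormB.
move=> xy; exact: (norm_cvg_unique (cvg_cst (cnorm (x - y))) xy).
Qed.

Lemma ccvg_shift a x : ccvg a x -> ccvg (fun k => a k.+1) x.
Proof.
move=> /ccvgP H; apply/ccvgP => e /H[N HN]; exists N => p Np.
by apply: HN; rewrite ltnW.
Qed.

Lemma ccvg_near_cst a l N : (forall p, (N <= p)%N -> a p = l) -> ccvg a l.
Proof.
by move=> H; apply/ccvgP => e e0; exists N => p /H ->; rewrite subrr cnorm0.
Qed.

End Ccvg.
End Convergence.

(** * Square roots by iteration and boundedness of *-homomorphisms *)

Section StarHomBound.
Context {R : realType}.

Lemma normcR (r : R) : ComplexField.Normc.normc r%:C = `|r|.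
Proof. by rewrite /= expr0n addr0 sqrtr_sqr. Qed.

Lemma conjCR (r : R) : (r%:C : R[i])^* = r%:C.
Proof. by rewrite conj_Creal// complex_real. Qed.

Section Algebra.
Context {A : cstarAlgType R}.
Implicit Types x y z : A.

Lemma star1 : star 1 = 1 :> A.
Proof.
have : star (star 1 * 1) = 1 :> A by rewrite mulr1 starK.
by rewrite starM starK mulr1.
Qed.

Lemma cnorm1 : cnorm (1 : A) = 1.
Proof.
have := cnorm_starM (1 : A); rewrite star1 mulr1 expr2 => /eqP.
rewrite -{1}[cnorm 1]mulr1 => /eqP/mulfI -> //.
by apply/eqP => /cnorm0_eq0/eqP; rewrite oner_eq0.
Qed.

Lemma star_sum (I : Type) (r : seq I) (p : pred I) (F : I -> A) :
  star (\sum_(i <- r | p i) F i) = \sum_(i <- r | p i) star (F i).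
Proof. exact: (big_morph _ (@starD R A) star0). Qed.

Lemma starX x k : star (x ^+ k) = star x ^+ k.
Proof.
elim: k => [|k IH]; first by rewrite !expr0 star1.
by rewrite exprS starM IH -exprSr.
Qed.

Lemma unitaryX u k : unitary u -> unitary (u ^+ k : A).
Proof.
move=> [su us]; elim: k => [|k [IH1 IH2]].
  by split; rewrite expr0 star1 mulr1.
split; first by rewrite exprS starM mulrA -(mulrA _ (star u)) su mulr1.
by rewrite exprSr starM mulrA -(mulrA _ u) us mulr1.
Qed.

(** The classical iteration for [1 - sqrt (1 - x)], a solution [b] of [2 b = x + b^2]; it replaces
    functional calculus. *)
Definition half_iter x k := iter k (fun b => (2^-1)%:C *: (x + b * b)) 0.

Lemma half_iter_le x k : cnorm x <= 2^-1 * 2^-1 -> cnorm (half_iter x k) <= 2^-1.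
Proof.
move=> x4; elim: k => [|k IH]; first by rewrite cnorm0 invr_ge0.
rewrite [half_iter _ _]/= cnormZ normcR ger0_norm ?invr_ge0//.
have : cnorm (half_iter x k * half_iter x k) <= 2^-1 * 2^-1.
  by rewrite (le_trans (cnormM _ _))// ler_pM// cnorm_ge0.
have := cnormD x (half_iter x k * half_iter x k).
rewrite -/(half_iter x k); lra.
Qed.

(** The splitting [c^2 - b^2 = (c - b) c + b (c - b)] holds without commutation. As [b] and [c] have
    norm at most 1/2, squaring does not increase their distance, and the factor 1/2 of the iteration
    makes it contract. *)
Lemma half_iter_dist x k l : cnorm x <= 2^-1 * 2^-1 ->
  cnorm (half_iter x (k + l) - half_iter x k) <= 2^-1 ^+ k.
Proof.
move=> x4; elim: k => [|k IH].
  rewrite subr0 expr0 (le_trans (half_iter_le _ x4))//; lra.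
rewrite addSn [half_iter _ _.+1]/= [half_iter x k.+1]/=.
rewrite -/(half_iter x k) -/(half_iter x (k + l)).
set b := half_iter x k; set c := half_iter x (k + l).
rewrite -scalerBr cnormZ normcR ger0_norm ?invr_ge0// exprS.
rewrite ler_pM2l ?invr_gt0//.
have -> : x + c * c - (x + b * b) = (c - b) * c + b * (c - b).
  by rewrite mulrBl mulrBr addrA subrK opprD addrACA subrr add0r.
have b2 : cnorm b <= 2^-1 by exact: half_iter_le.
have c2 : cnorm c <= 2^-1 by exact: half_iter_le.
have := cnormD ((c - b) * c) (b * (c - b)).
have := cnormM (c - b) c; have := cnormM b (c - b).
have := cnorm_ge0 (c - b); move: IH; rewrite -/b -/c; nra.
Qed.

(* With [b] the limit of [half_iter], the fixed point equation
   [2 b = x^2 + b^2] gives [x^2 + (1 - b)^2 = 1]. *)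
Lemma sqrt_complement x : star x = x -> cnorm x <= 2^-1 ->
  exists z, [/\ star z = z, x * z = z * x & x * x + z * z = 1].
Proof.
move=> sx x2.
have x4 : cnorm (x * x) <= 2^-1 * 2^-1.
  by rewrite (le_trans (cnormM _ _))// ler_pM// cnorm_ge0.
pose s := half_iter (x * x).
have [|b /ccvgP bP] := @cnorm_complete R A s.
  move=> e e0.
  have /cvgrPdist_lt/(_ e e0)[N _ HN] : (fun k => 2^-1 ^+ k : R) @ \oo --> (0 : R).
    by apply: cvg_expr; rewrite ger0_norm ?invr_ge0//; lra.
  have main p q : (N <= p)%N -> (p <= q)%N -> cnorm (s q - s p) < e.
    move=> Np pq; rewrite -(subnKC pq) (le_lt_trans (half_iter_dist _ _ x4))//.
    by have := HN p Np; rewrite /= sub0r normrN ger0_norm// exprn_ge0// invr_ge0.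
  exists N => p q Np Nq; have [pq|/ltnW qp] := leqP p q.
    by rewrite cnormB main.
  by rewrite main.
have sS k : s k.+1 = (2^-1)%:C *: (x * x + s k * s k) by [].
have ss k : star (s k) = s k.
  elim: k => [|k IH]; first by rewrite star0.
  by rewrite sS starZ conjCR starD !starM sx IH.
have sc k : x * s k = s k * x.
  elim: k => [|k IH]; first by rewrite mulr0 mul0r.
  rewrite sS -scalerAr -scalerAl mulrDr mulrDl (mulrA x (s k)) IH.
  by rewrite -(mulrA (s k)) IH !mulrA.
have bs : star b = b.
  by apply: ccvg_unique (ccvg_eq _ (ccvg_star bP)) bP => k; rewrite ss.
have bc : x * b = b * x.
  apply: (@ccvg_unique _ _ (fun k => x * s k)); first exact: ccvgM (ccvg_cst _) bP.
  by apply: ccvg_eq (ccvgM bP (ccvg_cst x)) => k; rewrite sc.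
have bb : (2^-1)%:C *: (x * x + b * b) = b.
  apply: (@ccvg_unique _ _ (fun k => s k.+1)); last exact: ccvg_shift.
  exact/ccvgZ/ccvgD/ccvgM/bP/bP/ccvg_cst.
exists (1 - b); split; first by rewrite starB star1 bs.
  by rewrite mulrBr mulrBl mulr1 mul1r bc.
have {}bb : x * x + b * b = b + b.
  rewrite -[in RHS]bb -scalerDl -rmorphD/=.
  by rewrite (_ : 2^-1 + 2^-1 = 1) ?scale1r//; lra.
rewrite mulrBl mul1r mulrBr mulr1 opprB addrCA [x * x + _]addrA bb.
by rewrite addrK subrK.
Qed.

(* [x + i z] is unitary with real part [x]. *)
Lemma cnorm_le1_complement x z : star x = x -> star z = z -> x * z = z * x ->
  x * x + z * z = 1 -> cnorm x <= 1.
Proof.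
move=> sx sz xz xxzz.
pose v := x + 'i *: z.
have sv : star v = x - 'i *: z by rewrite starD starZ sx sz conjCi scaleNr.
have v1 : cnorm v = 1.
  have := cnorm_starM v; rewrite sv.
  have -> : (x - 'i *: z) * v = 1.
    rewrite /v mulrDr !mulrBl -!scalerAl -!scalerAr !scalerA -xz.
    by rewrite -['i * 'i]expr2 sqrCi scaleN1r opprK addrA subrK.
  rewrite cnorm1 => /esym/eqP; rewrite sqrf_eq1 => /orP[/eqP//|/eqP v1].
  by have := cnorm_ge0 v; rewrite v1 oppr_ge0 ler10.
have : cnorm (x + x) <= 2.
  have -> : x + x = v + star v by rewrite sv /v addrACA subrr addr0.
  by rewrite (le_trans (cnormD _ _))// cnorm_star v1.
have -> : x + x = (2%:R)%:C *: x by rewrite rmorph_nat scaler_nat mulr2n.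
by rewrite cnormZ normcR ger0_norm//; lra.
Qed.

End Algebra.

(** The relations of [sqrt_complement] are algebraic, so [f] carries them to [B], where they force
    norm at most 1. The constant 2 comes from rescaling a self-adjoint element to norm 1/2, where
    the iteration converges; general [x] follows from [star x * x] and the C*-identity. *)
Lemma starhom_bound (A B : cstarAlgType R) (f : {starhom A -> B}) (x : A) :
  cnorm (f x) <= 2 * cnorm x.
Proof.
have sa (h : A) : star h = h -> cnorm (f h) <= 2 * cnorm h.
  move=> sh; have [/cnorm0_eq0 ->|h0] := eqVneq (cnorm h) 0.
    by rewrite raddf0 !cnorm0 mulr0.
  have {h0}h0 : 0 < cnorm h by rewrite lt_neqAle eq_sym h0 cnorm_ge0.
  pose c := (2 * cnorm h)^-1; have c0 : 0 < c by rewrite invr_gt0 mulr_gt0.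
  have sch : star (c%:C *: h) = c%:C *: h by rewrite starZ conjCR sh.
  have nch : cnorm (c%:C *: h) <= 2^-1.
    by rewrite cnormZ normcR gtr0_norm// /c invfM -mulrA mulVf ?gt_eqF// mulr1.
  have [z [sz hz hhzz]] := sqrt_complement sch nch.
  have := @cnorm_le1_complement B (f (c%:C *: h)) (f z).
  rewrite -!starhom_star -!rmorphM -rmorphD hhzz hz rmorph1 sz starZ conjCR sh.
  move=> /(_ erefl erefl erefl erefl); rewrite linearZ/= cnormZ normcR gtr0_norm//.
  by rewrite mulrC ler_pdivrMr ?mul1r// mulr_gt0.
have : cnorm (f x) ^+ 2 <= (2 * cnorm x) ^+ 2.
  rewrite -cnorm_starM -starhom_star -rmorphM (le_trans (sa _ _))//.
    by rewrite starM starK.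
  by rewrite cnorm_starM exprMn ler_wpM2r ?sqr_ge0//; lra.
by rewrite ler_pXn2r// nnegrE ?mulr_ge0 ?cnorm_ge0.
Qed.

End StarHomBound.

Section StarHomBuild.
Context {R : realType} (A B : cstarAlgType R) (f : A -> B).
Hypotheses (fD : forall x y, f (x + y) = f x + f y)
  (fZ : forall (c : R[i]) x, f (c *: x) = c *: f x)
  (f1 : f 1 = 1) (fM : forall x y, f (x * y) = f x * f y)
  (fs : forall x, f (star x) = star (f x)).

Lemma starhom_build : exists F : {starhom A -> B}, F =1 f.
Proof.
have fL : linear f by move=> c x y; rewrite fD fZ.
pose F : StarHom.type A B := HB.pack f
  (@GRing.isLinear.Build R[i] A B *:%R f fL)
  (@GRing.isMonoidMorphism.Build A B f (f1, fM))
  (isStarPreserving.Build R A B f fs).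
by exists F.
Qed.

End StarHomBuild.

(** * Constructing and comparing *-homomorphisms *)

Section StarHomTheory.
Context {R : realType}.
Implicit Types A B D : cstarAlgType R.

Lemma starhom_id A : exists F : {starhom A -> A}, F =1 id.
Proof. exact: starhom_build. Qed.

Lemma starhom_comp A B D (f : {starhom A -> B}) (g : {starhom B -> D}) :
  exists F : {starhom A -> D}, F =1 (fun x => g (f x)).
Proof.
apply: starhom_build => *; rewrite ?rmorphD ?linearZ ?rmorph1 ?rmorphM //=.
by rewrite !starhom_star.
Qed.

Lemma starhom_lim A B (f : nat -> {starhom A -> B}) :
  (forall x, exists l, ccvg (fun k => f k x) l) ->
  exists F : {starhom A -> B}, forall x, ccvg (fun k => f k x) (F x).
Proof.
move=> /choice[F FP]; have FE x l : ccvg (fun k => f k x) l -> F x = l.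
  exact: ccvg_unique.
have [|||||G GF] := @starhom_build R A B F.
- move=> x y; apply/FE/(ccvg_eq _ (ccvgD (FP x) (FP y))) => k.
  by rewrite rmorphD.
- by move=> c x; apply/FE/(ccvg_eq _ (ccvgZ c (FP x))) => k; rewrite linearZ.
- by apply/FE/(ccvg_eq _ (ccvg_cst 1)) => k; rewrite rmorph1.
- move=> x y; apply/FE/(ccvg_eq _ (ccvgM (FP x) (FP y))) => k.
  by rewrite rmorphM.
- move=> x; apply/FE/(ccvg_eq _ (ccvg_star (FP x))) => k.
  by rewrite starhom_star.
by exists G => x; rewrite GF.
Qed.

Lemma starhom_eq_closed A B (f g : {starhom A -> B}) :
  cnorm_closed [set x | f x = g x].
Proof.
move=> x xfg; apply/eqP; rewrite -subr_eq0; apply/eqP/cnorm0_eq0/eqP.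
rewrite eq_le cnorm_ge0 andbT; apply/ler_addgt0Pr => e e0; rewrite add0r.
have [y fgy xy] := xfg (e / 4) (divr_gt0 e0 (ltr0Sn _ _)).
have -> : f x - g x = f (x - y) - g (x - y).
  by rewrite !rmorphB /= fgy opprB subrKA.
rewrite (le_trans (cnormD _ _))// cnormN.
have := starhom_bound f (x - y); have := starhom_bound g (x - y); lra.
Qed.

Lemma starhom_eq_subalgebra A B (f g : {starhom A -> B}) :
  star_subalgebra [set x | f x = g x].
Proof.
split=> /=.
- by rewrite !rmorph1.
- by move=> x y fgx fgy; rewrite !rmorphD /= fgx fgy.
- by move=> c x fgx; rewrite !linearZ /= fgx.
- by move=> x y fgx fgy; rewrite !rmorphM /= fgx fgy.
- by move=> x fgx; rewrite !starhom_star fgx.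
Qed.

Lemma starhom_eq_generated A B D (i : A -> B) (u : B) (f g : {starhom B -> D}) :
  generated_by i u -> (forall a, f (i a) = g (i a)) -> f u = g u -> f =1 g.
Proof.
move=> gen fgi fgu x.
have /= := gen _ (starhom_eq_subalgebra f g) (@starhom_eq_closed _ _ f g) fgi fgu.
by move/seteqP => [_ /(_ x I)].
Qed.

Lemma starhom_eq_dense A B (S : set A) (f g : {starhom A -> B}) :
  cnorm_dense S -> (forall x, S x -> f x = g x) -> f =1 g.
Proof.
move=> dS fg x; apply: starhom_eq_closed => e e0.
by have [y Sy xy] := dS x e e0; exists y => //; exact: fg.
Qed.

(** The elements whose image commutes with [p] form a subalgebra, stable under [star] because [p] is
    self-adjoint and closed because [f] is bounded. *)
Lemma starhom_comm_generated A B D (i : A -> B) (u : B) (f : {starhom B -> D}) p :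
  generated_by i u -> star p = p ->
  (forall a, f (i a) * p = p * f (i a)) -> f u * p = p * f u ->
  forall x, f x * p = p * f x.
Proof.
move=> gen sp fip fup x.
suff S1 : [set x | f x * p = p * f x] = setT.
  by have /seteqP[_ /(_ x I)] := S1.
apply: gen => //; first split=> /=.
- by rewrite rmorph1 mul1r mulr1.
- by move=> y z fy fz; rewrite rmorphD /= mulrDl mulrDr fy fz.
- by move=> c y fy; rewrite linearZ /= -scalerAl -scalerAr fy.
- by move=> y z fy fz; rewrite rmorphM /= -mulrA fz mulrA fy mulrA.
- by move=> y fy; rewrite starhom_star -{1}sp -starM -fy starM sp.
move=> y yS; apply/eqP; rewrite -subr_eq0; apply/eqP/cnorm0_eq0/eqP.
rewrite eq_le cnorm_ge0 andbT; apply/ler_addgt0Pr => e e0; rewrite add0r.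
(* The 4 counts two products, each with the bound 2 on [f]; the added 1 keeps the divisor positive
   when [p] is zero. *)
have M0 : 0 < 4 * cnorm p + 1 by rewrite ltr_wpDl// mulr_ge0// cnorm_ge0.
have [z /= fz yz] := yS (e / (4 * cnorm p + 1)) (divr_gt0 e0 M0).
have -> : f y * p - p * f y = f (y - z) * p - p * f (y - z).
  by rewrite rmorphB /= mulrBl mulrBr fz opprB subrKA.
rewrite (le_trans (cnormD _ _))// cnormN.
rewrite ltr_pdivlMr// in yz.
have := cnormM (f (y - z)) p; have := cnormM p (f (y - z)).
have := ler_wpM2r (cnorm_ge0 p) (starhom_bound f (y - z)).
have := cnorm_ge0 (y - z).
nra.
Qed.

End StarHomTheory.

(** * Matrix algebras, their representations, and equality of maps out of them *)

Section MatrixUnits.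
Context {R : realType}.

Section Elem.
Context {E : cstarAlgType R} {n : nat}.
Implicit Types x y : E.

Lemma mx_elemM i j k l x y : (j < n)%N ->
  mx_elem n i j x *m mx_elem n k l y = if j == k then mx_elem n i l (x * y) else 0.
Proof.
move=> jn; apply/matrixP => p q; rewrite !mxE (bigD1 (Ordinal jn)) //= big1 => [|r].
  rewrite !mxE /= eqxx andbT addr0; have [_|_] := eqVneq j k; rewrite mxE /=.
    by case: eqP; case: eqP => //=; rewrite ?mul0r ?mulr0.
  by rewrite mulr0.
rewrite -val_eqE /= => /negbTE rj; rewrite !mxE /= rj andbF mul0r //.
Qed.

Lemma mx_elemD i j : {morph @mx_elem R E n i j : x y / x + y}.
Proof. by move=> x y; apply/matrixP => p q; rewrite !mxE; case: ifP; rewrite ?addr0. Qed.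

Lemma mx_elemZ i j (c : R[i]) x :
  mx_elem n i j (c *: x) = map_mx ( *:%R c) (mx_elem n i j x).
Proof. by apply/matrixP => p q; rewrite !mxE; case: ifP; rewrite ?scaler0. Qed.

Lemma mx_elem_star i j x :
  mx_elem n j i (star x) = map_mx star (mx_elem n i j x)^T.
Proof.
by apply/matrixP => p q; rewrite !mxE andbC; case: ifP; rewrite ?star0.
Qed.

Lemma mx_elem_sum (M : 'M[E]_n) : M = \sum_(i < n) \sum_(j < n) mx_elem n i j (M i j).
Proof.
apply/matrixP => p q; rewrite summxE (bigD1 p)//= summxE (bigD1 q)//= mxE !eqxx.
rewrite !big1 ?addr0// => [i ip|j jq].
  rewrite summxE big1// => j _; rewrite mxE val_eqE eq_sym (negbTE ip)//.
by rewrite mxE !val_eqE [q == j]eq_sym (negbTE jq) andbF.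
Qed.

Lemma mx_elem1_sum : \sum_(i < n) mx_elem n i i (1 : E) = 1%:M.
Proof.
apply/matrixP => p q; rewrite summxE (bigD1 p)//= !mxE !val_eqE eqxx /=.
rewrite big1 ?addr0 => [|i ip]; first by rewrite eq_sym; case: eqP.
by rewrite mxE !val_eqE eq_sym (negbTE ip).
Qed.

End Elem.

(** In a product of two images the inner factors meet as [e 0 k * e k 0 = e 0 0], so the entries
    multiply inside the corner. This is why [phi] has to commute with [e 0 0] only. *)
Lemma matrix_algebra_starhom (n : nat) (E B D : cstarAlgType R)
    (Phi : {rmorphism 'M[E]_n -> B}) (phi : {starhom E -> D})
    (e : nat -> nat -> D) :
  is_matrix_algebra Phi -> (0 < n)%N ->
  (forall i j k l, (i < n)%N -> (j < n)%N -> (k < n)%N -> (l < n)%N ->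
     e i j * e k l = if j == k then e i l else 0) ->
  (forall i j, (i < n)%N -> (j < n)%N -> star (e i j) = e j i) ->
  \sum_(i < n) e i i = 1 ->
  (forall x, phi x * e 0%N 0%N = e 0%N 0%N * phi x) ->
  exists rho : {starhom B -> D}, forall i j x, (i < n)%N -> (j < n)%N ->
    rho (Phi (mx_elem n i j x)) = e i 0%N * phi x * e 0%N j.
Proof.
move=> [[Psi PhiK PsiK] PhiZ Phis] n0 eM es e1 phie.
pose G (M : 'M[E]_n) := \sum_(i < n) \sum_(j < n) e i 0%N * phi (M i j) * e 0%N j.
have PsiD x y : Psi (x + y) = Psi x + Psi y.
  by apply: (can_inj PhiK); rewrite rmorphD /= !PsiK.
have PsiM x y : Psi (x * y) = Psi x *m Psi y.
  by apply: (can_inj PhiK); rewrite [RHS]rmorphM /= !PsiK.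
have Psi1 : Psi 1 = 1%:M.
  by apply: (can_inj PhiK); rewrite [RHS]rmorph1 PsiK.
have PsiZ (c : R[i]) x : Psi (c *: x) = map_mx ( *:%R c) (Psi x).
  by apply: (can_inj PhiK); rewrite PhiZ !PsiK.
have Psis x : Psi (star x) = map_mx star (Psi x)^T.
  by apply: (can_inj PhiK); rewrite Phis !PsiK.
have [|||||rho rhoE] := @starhom_build R B D (fun b => G (Psi b)).
- move=> x y; rewrite PsiD /G -big_split; apply: eq_bigr => i _ /=.
  rewrite -big_split; apply: eq_bigr => j _ /=.
  by rewrite mxE rmorphD /= mulrDr mulrDl.
- move=> c x; rewrite PsiZ /G scaler_sumr; apply: eq_bigr => i _ /=.
  rewrite scaler_sumr; apply: eq_bigr => j _ /=.
  by rewrite mxE linearZ /= -scalerAr -scalerAl.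
- rewrite Psi1 /G -[RHS]e1; apply: eq_bigr => i _.
  rewrite (bigD1 i)//= mxE eqxx rmorph1 mulr1 eM// big1 ?addr0//.
  move=> j ji; rewrite mxE eq_sym (negbTE ji) raddf0 mulr0 mul0r //.
- move=> x y; rewrite PsiM /G mulr_suml; apply: eq_bigr => i _.
  have entry (k : 'I_n) : e i 0%N * phi (Psi x i k) * e 0%N k *
      (\sum_(p < n) \sum_(j < n) e p 0%N * phi (Psi y p j) * e 0%N j) =
      \sum_(j < n) e i 0%N * phi (Psi x i k * Psi y k j) * e 0%N j.
    rewrite mulr_sumr (bigD1 k)//= [X in _ + X]big1 ?addr0 => [|l lk].
      rewrite mulr_sumr; apply: eq_bigr => j _.
      rewrite !mulrA -(mulrA _ (e 0%N k)) eM// eqxx -(mulrA (e i 0%N)).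
      by rewrite phie mulrA eM// rmorphM mulrA.
    rewrite mulr_sumr big1// => j _; rewrite !mulrA -(mulrA _ (e 0%N k)) eM//.
    by rewrite val_eqE eq_sym (negbTE lk) mulr0 !mul0r.
  rewrite mulr_suml (eq_bigr _ (fun k _ => entry k)) exchange_big.
  apply: eq_bigr => j _ /=; rewrite mxE rmorph_sum mulr_sumr mulr_suml /=.
  by apply: eq_bigr => k _.
- move=> x; rewrite Psis /G star_sum exchange_big; apply: eq_bigr => i _ /=.
  rewrite star_sum; apply: eq_bigr => j _.
  by rewrite !mxE !starM !es// starhom_star mulrA.
exists rho => i j x ltin ltjn; rewrite rhoE PhiK /G.
rewrite (bigD1 (Ordinal ltin))//= (bigD1 (Ordinal ltjn))//= mxE /= !eqxx.
rewrite !big1 ?addr0// => [k|k].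
  rewrite -val_eqE /= => /negbTE ki; apply: big1 => l _.
  by rewrite mxE ki raddf0 mulr0 mul0r.
rewrite -val_eqE /= => /negbTE kj.
by rewrite mxE kj andbF raddf0 mulr0 mul0r.
Qed.

Lemma mx_elem_scalar (E : cstarAlgType R) n i j (x : E) :
  mx_elem n i j x = mx_elem n i j 1 *m x%:M.
Proof.
apply/matrixP => p q; rewrite !mxE (bigD1 q)//= big1 ?addr0 => [|r rq].
  by rewrite !mxE eqxx; case: ifP; rewrite ?mul1r ?mul0r.
by rewrite !mxE (negbTE rq) mulr0.
Qed.

Lemma matrix_algebra_scalar (n : nat) (E B : cstarAlgType R)
    (Phi : {rmorphism 'M[E]_n -> B}) : is_matrix_algebra Phi ->
  exists d : {starhom E -> B}, forall x, d x = Phi x%:M.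
Proof.
move=> [_ PhiZ Phis]; apply: starhom_build.
- by move=> x y; rewrite !raddfD.
- move=> c x; rewrite -PhiZ; congr (Phi _); apply/matrixP => i j.
  by rewrite !mxE; case: eqP; rewrite ?mulr1n ?mulr0n ?scaler0.
- by rewrite -[RHS](rmorph1 Phi).
- by move=> x y; rewrite scalar_mxM [LHS]rmorphM.
- move=> x; rewrite -Phis; congr (Phi _); apply/matrixP => i j.
  by rewrite !mxE eq_sym; case: eqP; rewrite ?mulr1n ?mulr0n ?star0.
Qed.

(** Generation of [E] concerns unital maps, and the corner embedding of [E] is not unital when
    [n > 1]. So [f] and [g] are compared on scalar matrices, which are recovered from the corner by
    conjugating with [mx_elem n i 0 1] and summing over [i]. *)
Lemma matrix_algebra_starhom_eq (n : nat) (A E B D : cstarAlgType R)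
    (iota : A -> E) (u : E) (Phi : {rmorphism 'M[E]_n -> B})
    (f g : {starhom B -> D}) :
  generated_by iota u -> is_matrix_algebra Phi -> (0 < n)%N ->
  (forall a, f (Phi (mx_elem n 0%N 0%N (iota a))) =
             g (Phi (mx_elem n 0%N 0%N (iota a)))) ->
  f (Phi (mx_elem n 0%N 0%N u)) = g (Phi (mx_elem n 0%N 0%N u)) ->
  (forall i j, (i < n)%N -> (j < n)%N ->
     f (Phi (mx_elem n i j 1)) = g (Phi (mx_elem n i j 1))) ->
  f =1 g.
Proof.
move=> gen PhiM n0 fgi fgu fge.
have [d dE] := matrix_algebra_scalar PhiM.
have [fd fdE] := starhom_comp d f; have [gd gdE] := starhom_comp d g.
have fgd x : f (Phi (mx_elem n 0%N 0%N x)) = g (Phi (mx_elem n 0%N 0%N x)) ->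
    fd x = gd x.
  have -> y : (fd y = gd y) = (f (Phi y%:M) = g (Phi y%:M)) by rewrite fdE gdE dE.
  have -> : x%:M = \sum_(i < n) (mx_elem n i 0%N 1 *m mx_elem n 0%N 0%N x *m
      mx_elem n 0%N i 1).
    rewrite -[LHS]mul1mx -mx_elem1_sum mulmx_suml; apply: eq_bigr => i _.
    by rewrite !mx_elemM// mul1r mulr1 -mx_elem_scalar.
  move=> fgx; rewrite !rmorph_sum; apply: eq_bigr => i _.
  by rewrite !rmorphM /= !fge// fgx.
have {}fgd : fd =1 gd by apply: starhom_eq_generated gen _ _ => [a|]; exact: fgd.
case: PhiM => [[Psi _ PsiK] _ _] b.
rewrite -(PsiK b) (mx_elem_sum (Psi b)) !rmorph_sum; apply: eq_bigr => i _.
rewrite !rmorph_sum; apply: eq_bigr => j _.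
rewrite mx_elem_scalar !rmorphM /= fge//; congr (_ * _).
by rewrite -!dE -fdE -gdE.
Qed.

End MatrixUnits.

(** * Digits of the odometer *)

Section OdometerDigits.
Context (n m : nat -> nat).
Hypotheses (n_gt0 : forall k, (0 < n k)%N) (n_start : n 0%N = 1%N)
  (n_dvd : forall k, (n k %| n k.+1)%N)
  (m_def : forall i, m i = (n i.+1 %/ n i)%N).
Local Notation X := (odometer_space m).
Implicit Types x y : X.

Lemma nS k : n k.+1 = (m k * n k)%N.
Proof. by rewrite m_def divnK. Qed.

Lemma m_gt0 k : (0 < m k)%N.
Proof. by have := n_gt0 k.+1; rewrite nS muln_gt0 => /andP[]. Qed.

Lemma digit_le x k : (x k <= (m k).-1)%N.
Proof. by rewrite -ltnS; exact: ltn_ord. Qed.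

Lemma digit_lt x k : (x k < m k)%N.
Proof. by rewrite -[ltnRHS](prednK (m_gt0 k)) ltnS digit_le. Qed.

(* The odometer is addition of [1] in mixed radix, least significant digit
   first. *)
Fixpoint digit_sum k x : nat :=
  if k is k'.+1 then (digit_sum k' x + x k' * n k')%N else 0%N.

Lemma digit_sum_lt k x : (digit_sum k x < n k)%N.
Proof.
elim: k => [|k IH] /=; first by rewrite n_start.
have := digit_lt x k; rewrite nS; nia.
Qed.

Lemma digit_sumP k x y :
  reflect (forall i, (i < k)%N -> x i = y i) (digit_sum k x == digit_sum k y).
Proof.
apply: (iffP eqP) => [|xy]; last first.
  elim: k xy => //= k IH xy; rewrite xy// IH// => i ik.
  by rewrite xy// ltnW.
elim: k => //= k IH xy.
have dk z : ((digit_sum k z + z k * n k) %% n k = digit_sum k z)%N.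
  by rewrite addnC modnMDl modn_small// digit_sum_lt.
have eqk : digit_sum k x = digit_sum k y by rewrite -dk xy dk.
move=> i; rewrite ltnS leq_eqVlt => /predU1P[->|]; last exact: IH.
apply/val_inj/eqP; rewrite -(eqn_pmul2r (n_gt0 k)).
by rewrite -(eqn_add2l (digit_sum k x)) {2}eqk xy.
Qed.

Lemma digit_sum_le k l x y : (k <= l)%N ->
  digit_sum l x = digit_sum l y -> digit_sum k x = digit_sum k y.
Proof.
move=> kl /eqP/digit_sumP xy; apply/eqP/digit_sumP => i ik.
by apply/xy/(leq_trans ik).
Qed.

Lemma odometer_lt_carry x i j : carry_index x = Some j -> (i < j)%N ->
  odometer x i = ord0.
Proof. by rewrite /odometer => -> ->. Qed.

Lemma digit_sum_full k x : (forall i, (i < k)%N -> nat_of_ord (x i) = (m i).-1) ->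
  (digit_sum k x).+1 = n k.
Proof.
elim: k => [|k IH] xm /=; first by rewrite n_start.
rewrite -addSn IH => [|i ik]; last by rewrite xm// ltnW.
by rewrite xm// nS -mulSn prednK// m_gt0.
Qed.

Lemma digit_sum_zero k x : (forall i, (i < k)%N -> nat_of_ord (x i) = 0%N) ->
  digit_sum k x = 0%N.
Proof.
elim: k => //= k IH xm; rewrite IH => [|i ik]; last by rewrite xm// ltnW.
by rewrite xm.
Qed.

Lemma digit_sum_tail j k x y : (forall i, (j <= i)%N -> x i = y i) -> (j <= k)%N ->
  (digit_sum k x + digit_sum j y = digit_sum k y + digit_sum j x)%N.
Proof.
move=> xy; elim: k => [|k IH]; first by rewrite leqn0 => /eqP ->.
rewrite leq_eqVlt => /predU1P[->|/[!ltnS] jk]; first by rewrite addnC.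
by move: (IH jk); rewrite /= xy//; lia.
Qed.

Lemma carry_none x : carry_index x = None ->
  forall i, nat_of_ord (x i) = (m i).-1.
Proof.
rewrite /carry_index; case: pselect => // xm _ i.
apply/eqP; rewrite eqn_leq digit_le leqNgt.
by apply/negP => xi; apply: xm; exists i.
Qed.

Lemma carry_some x j : carry_index x = Some j ->
  (x j < (m j).-1)%N /\ forall i, (i < j)%N -> nat_of_ord (x i) = (m i).-1.
Proof.
rewrite /carry_index; case: pselect => // ex [].
case: ex_minnP => l xl lmin <-; split=> // i il.
apply/eqP; rewrite eqn_leq digit_le leqNgt.
by apply/negP => /lmin; rewrite leqNgt il.
Qed.

(** If the carry stops below [k], the full digits contribute [n j - 1] and are traded for one more
    unit [n j]. Otherwise the first [k] digits are all full and become zero: the sum drops from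
    [n k - 1] to 0, whence the congruence. *)
Lemma digit_sum_odometer k x :
  (digit_sum k (odometer x) = (digit_sum k x).+1 %[mod n k])%N.
Proof.
case E : (carry_index x) => [j|]; last first.
  rewrite (digit_sum_full (fun i _ => carry_none E i)) modnn digit_sum_zero ?mod0n//.
  by move=> i _; rewrite /odometer E.
have [xj xfull] := carry_some E.
have x0 i : (i < j)%N -> nat_of_ord (odometer x i) = 0%N.
  by move=> ij; rewrite (odometer_lt_carry E ij).
have [kj|jk] := leqP k j.
  rewrite digit_sum_full => [|i ik]; last by rewrite xfull// (leq_trans ik).
  by rewrite modnn digit_sum_zero ?mod0n// => i ik; rewrite x0// (leq_trans ik).
congr (_ %% _)%N.
have tail : forall i, (j.+1 <= i)%N -> odometer x i = x i.
  by move=> i ji; rewrite /odometer E ltnNge ltnW//= gtn_eqF.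
have := digit_sum_tail tail jk.
have -> : digit_sum j.+1 (odometer x) = (n j + x j * n j)%N.
  by rewrite /= digit_sum_zero// /odometer E ltnn eqxx inordK ?mulSn//.
by rewrite /= -(digit_sum_full xfull); lia.
Qed.

Lemma near_digit x i : \forall y \near x, y i = x i.
Proof.
have := @proj_continuous nat (fun i => discrete_topology 'I_(m i).-1.+1) i x.
move=> /(_ [set x i] (discrete_set1 _)); exact.
Qed.

Lemma near_digit_sum k x : \forall y \near x, digit_sum k y = digit_sum k x.
Proof.
elim: k => [|k IH]; first by apply: filterE.
by apply: filterS2 IH (near_digit x k) => y /= -> ->.
Qed.

(** The product topology is a supremum of topologies pulled back from the coordinates, so the filter
    of cylinders is tested on one digit [i] at a time, and [digit_sum i.+1] determines that
    digit. *)
Lemma nbhs_digit_sum x (U : set X) : nbhs x U ->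
  exists k, forall y, digit_sum k y = digit_sum k x -> U y.
Proof.
pose F := filter_from [set: nat] (fun k => [set y | digit_sum k y = digit_sum k x]).
have FF : Filter F.
  apply: filter_from_filter; first by exists 0%N.
  move=> k l _ _; exists (maxn k l) => // y /= yx.
  by split; apply: digit_sum_le yx; rewrite ?leq_maxl ?leq_maxr.
suff /[apply] -[k _ kU] : F --> x by exists k.
apply/cvg_sup => i U' [_ [[C _ <-] Cx] CU].
exists i.+1 => // y /eqP/digit_sumP/(_ i (ltnSn _)) yx.
by apply: CU; move: Cx; rewrite /= /mathcomp_extra.proj yx.
Qed.

Lemma cfun_uniform (R : realType) (A : cstarAlgType R) (f : Cfun X A) (e : R) :
  0 < e -> exists k, forall x y, digit_sum k x = digit_sum k y ->
    cnorm (f x - f y) < e.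
Proof.
move=> e0; apply: contrapT => /forallNP H.
have /choice[s sP] : forall k, exists xy : X * X,
    digit_sum k xy.1 = digit_sum k xy.2 /\ e <= cnorm (f xy.1 - f xy.2).
  move=> k; apply: contrapT => /forallNP Hk; apply: (H k) => x y xy.
  by rewrite ltNge; apply/negP => exy; apply: (Hk (x, y)).
(* Bad pairs exist at every level, and their first members cluster at some [z]. A pair of level
   [l >= k] with first member in the level-[k] cylinder of [z] has its second member there too, so
   both values are within [e / 2] of [f z]. *)
have [z [_ cz]] := @odometer_compact m ((fun k => (s k).1) @ \oo) _ filterT.
have e2 : 0 < e / 2 by rewrite divr_gt0.
have [k kP] := nbhs_digit_sum (@cfun_continuous _ _ _ f z _ e2).
have near_z : nbhs z [set y | digit_sum k y = digit_sum k z].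
  exact: near_digit_sum.
have tail : ((fun k => (s k).1) @ \oo) [set (s l).1 | l in [set l | (k <= l)%N]].
  by exists k => // l kl; exists l.
have [_ [[l /= kl <-] sz]] := cz _ _ tail near_z.
have [sl] := sP l; rewrite leNgt => /negP; apply.
rewrite -(subrKA (f z)) (le_lt_trans (cnormD _ _))// (splitr e) ltrD//.
  exact: kP.
rewrite cnormB; apply: kP; rewrite -sz.
by apply: (digit_sum_le kl); rewrite sl.
Qed.

End OdometerDigits.

(** * Matrix units with a covariant corner *)

Section Corner.
Context {R : realType} {A : cstarAlgType R}.

(* [F] is an [n] x [n] system of matrix units in [D], and [t], [U] form a
   covariant representation of [(A, beta)] in the corner cut out by [F 0 0]. *)
Record corner_system (D : cstarAlgType R) (n : nat) (beta : A -> A)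
    (F : nat -> nat -> D) (t : A -> D) (U : D) : Prop := CornerSystem {
  cornerM : forall i j k l, (j < n)%N ->
    F i j * F k l = if j == k then F i l else 0;
  corner_star : forall i j, star (F i j) = F j i;
  corner_sum : \sum_(i < n) F i i = 1;
  corner_tD : forall a b, t (a + b) = t a + t b;
  corner_tZ : forall (c : R[i]) a, t (c *: a) = c *: t a;
  corner_tM : forall a b, t (a * b) = t a * t b;
  corner_tstar : forall a, t (star a) = star (t a);
  corner_t1 : t 1 = F 0%N 0%N;
  corner_FU : F 0%N 0%N * U = U;
  corner_UU : U * star U = F 0%N 0%N;
  corner_sUU : star U * U = F 0%N 0%N;
  corner_Ut : forall a, U * t a * star U = t (beta a)
}.

Lemma matrix_corner_system (n : nat) (beta : A -> A) (E B D : cstarAlgType R)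
    (iota : {starhom A -> E}) (u : E) (Phi : {rmorphism 'M[E]_n -> B})
    (mu : {starhom B -> D}) : (0 < n)%N ->
  covariant beta iota u -> is_matrix_algebra Phi ->
  corner_system n beta (fun i j => mu (Phi (mx_elem n i j 1)))
    (fun a => mu (Phi (mx_elem n 0%N 0%N (iota a))))
    (mu (Phi (mx_elem n 0%N 0%N u))).
Proof.
move=> n0 [[su us] uiota] [_ PhiZ Phis].
have TM (M N : 'M[E]_n) : mu (Phi M) * mu (Phi N) = mu (Phi (M *m N)).
  by rewrite -[M *m N]/(M * N) !rmorphM.
have Ts i j x : star (mu (Phi (mx_elem n i j x))) = mu (Phi (mx_elem n j i (star x))).
  by rewrite -starhom_star -Phis mx_elem_star.
split=> *; rewrite ?Ts ?TM ?mx_elemM ?star1 ?mul1r ?mulr1//.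
- by case: ifP => // _; rewrite !raddf0.
- by rewrite -!rmorph_sum mx_elem1_sum -[RHS](rmorph1 mu) -(rmorph1 Phi).
- by rewrite rmorphD mx_elemD !rmorphD.
- by rewrite linearZ /= mx_elemZ PhiZ linearZ.
- by rewrite rmorphM.
- by rewrite starhom_star.
- by rewrite rmorph1.
- by rewrite us.
- by rewrite su.
- by rewrite -uiota.
Qed.

Section Theory.
Context {D : cstarAlgType R} {n : nat} {beta : A -> A} {F : nat -> nat -> D}
  {t : A -> D} {U : D}.
Hypothesis n0 : (0 < n)%N.
Hypothesis cF : corner_system n beta F t U.

Lemma corner_Ft a : F 0%N 0%N * t a = t a.
Proof. by rewrite -(corner_t1 cF) -(corner_tM cF) mul1r. Qed.

Lemma corner_tF a : t a * F 0%N 0%N = t a.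
Proof. by rewrite -(corner_t1 cF) -(corner_tM cF) mulr1. Qed.

Lemma corner_t0 : t 0 = 0.
Proof. by rewrite -(scale0r 0) (corner_tZ cF) scale0r. Qed.

(** The image in [D] of the diagonal matrix with entries [d 0, ..., d n.-1]. *)
Definition corner_diag (d : nat -> A) := \sum_(i < n) F i 0%N * t (d i) * F 0%N i.

Lemma eq_corner_diag d d' : (forall i, (i < n)%N -> d i = d' i) ->
  corner_diag d = corner_diag d'.
Proof. by move=> dd'; apply: eq_bigr => i _; rewrite dd'. Qed.

Lemma corner_diagD d d' :
  corner_diag (fun i => d i + d' i) = corner_diag d + corner_diag d'.
Proof.
rewrite /corner_diag -big_split; apply: eq_bigr => i _ /=.
by rewrite (corner_tD cF) mulrDr mulrDl.
Qed.

Lemma corner_diagZ (c : R[i]) d :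
  corner_diag (fun i => c *: d i) = c *: corner_diag d.
Proof.
rewrite /corner_diag scaler_sumr; apply: eq_bigr => i _ /=.
by rewrite (corner_tZ cF) -scalerAr -scalerAl.
Qed.

Lemma corner_diagM d d' :
  corner_diag (fun i => d i * d' i) = corner_diag d * corner_diag d'.
Proof.
rewrite /corner_diag mulr_suml; apply: eq_bigr => i _ /=.
rewrite mulr_sumr (bigD1 i)//= big1 => [|j ji]; rewrite !mulrA.
  rewrite -(mulrA _ (F 0%N i)) (cornerM cF)// eqxx addr0.
  by rewrite -(mulrA _ (t (d i))) corner_tF (corner_tM cF) !mulrA.
rewrite -(mulrA _ (F 0%N i)) (cornerM cF)// val_eqE eq_sym (negbTE ji).
by rewrite mulr0 !mul0r.
Qed.

Lemma corner_diag_star d : corner_diag (fun i => star (d i)) = star (corner_diag d).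
Proof.
rewrite /corner_diag star_sum; apply: eq_bigr => i _ /=.
by rewrite !starM !(corner_star cF) (corner_tstar cF) mulrA.
Qed.

Lemma corner_diag1 : corner_diag (fun=> 1) = 1.
Proof.
rewrite -[RHS](corner_sum cF); apply: eq_bigr => i _.
by rewrite (corner_t1 cF) !(cornerM cF).
Qed.

Lemma corner_diag_starhom (C : cstarAlgType R) (d : nat -> {starhom C -> A}) :
  exists pi : {starhom C -> D}, forall f, pi f = corner_diag (fun i => d i f).
Proof.
apply: starhom_build => [f g|c f||f g|f].
- by rewrite -corner_diagD; apply: eq_corner_diag => i _; rewrite rmorphD.
- by rewrite -corner_diagZ; apply: eq_corner_diag => i _; rewrite linearZ.
- by rewrite -corner_diag1; apply: eq_corner_diag => i _; rewrite rmorph1.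
- by rewrite -corner_diagM; apply: eq_corner_diag => i _; rewrite rmorphM.
- by rewrite -corner_diag_star; apply: eq_corner_diag => i _; rewrite starhom_star.
Qed.

(* The relations satisfied by the image [v] of the generating unitary of
   [M_1 (A x Z)]: [v] shifts the matrix units, and wraps around through [U]. *)
Definition corner_shift (v : D) :=
  (forall j, (j.+1 < n)%N -> F 0%N j * v = F 0%N j.+1) /\ F 0%N n.-1 * v = U.

Lemma corner_shiftX v j : corner_shift v -> (j < n)%N ->
  F 0%N 0%N * v ^+ j = F 0%N j.
Proof.
move=> [vF _]; elim: j => [|j IH] jn; first by rewrite mulr1.
by rewrite exprSr mulrA IH ?(ltnW jn)// vF.
Qed.

Lemma corner_shiftXn v : corner_shift v -> F 0%N 0%N * v ^+ n = U.
Proof.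
move=> vF; rewrite -(prednK n0) exprSr mulrA (corner_shiftX vF) ?prednK//.
by case: vF.
Qed.

Lemma corner_shift_row v i j : corner_shift v -> (j.+1 < n)%N ->
  F i j * v = F i j.+1.
Proof.
move=> [vF _] jn.
have FF k : F i k = F i 0%N * F 0%N k by rewrite (cornerM cF).
by rewrite FF [RHS]FF -mulrA vF.
Qed.

Lemma corner_shift_wrap v i : corner_shift v -> F i n.-1 * v = F i 0%N * U.
Proof.
move=> [_ vU].
have -> : F i n.-1 = F i 0%N * F 0%N n.-1 by rewrite (cornerM cF).
by rewrite -mulrA vU.
Qed.

(** Conjugation by [v] moves diagonal entries one place up; entry 0 leaves the top and returns at
    the bottom through [U], which applies [beta] to it. *)
Lemma corner_shift_conj v d d' : unitary v -> corner_shift v ->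
  (forall i, (i.+1 < n)%N -> d' i = d i.+1) -> d' n.-1 = beta (d 0%N) ->
  v * corner_diag d * star v = corner_diag d'.
Proof.
move=> [sv vs] [vF vU] d'd d'n.
have Fv j : (j.+1 < n)%N -> F 0%N j.+1 * star v = F 0%N j.
  by move=> jn; rewrite -vF// -mulrA vs mulr1.
have Uv : U * star v = F 0%N n.-1 by rewrite -vU -mulrA vs mulr1.
have vFs j : (j.+1 < n)%N -> v * F j.+1 0%N = F j 0%N.
  by move=> jn; rewrite -(corner_star cF) -[v]starK -starM Fv// (corner_star cF).
have vUs : v * star U = F n.-1 0%N.
  by rewrite -[v]starK -starM Uv (corner_star cF).
have F00v : F 0%N 0%N * star v = star U * F 0%N n.-1.
  by rewrite -Uv mulrA (corner_sUU cF).
have vF00 : v * F 0%N 0%N = F n.-1 0%N * U.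
  by rewrite -vUs -mulrA (corner_sUU cF).
rewrite /corner_diag; case: n n0 d'd d'n Fv Uv vFs vUs F00v vF00 => // p _ /=.
move=> d'd d'n Fv Uv vFs vUs F00v vF00.
(* The first summand on the left is paired with the last on the right, and summand [i + 1] with
   summand [i]. *)
rewrite mulr_sumr mulr_suml big_ord_recl big_ord_recr /= addrC; congr (_ + _); last first.
  apply: eq_bigr => i _; rewrite /bump/= add1n !mulrA vFs ?ltnS// -(mulrA _ _ (star v)).
  by rewrite Fv ?ltnS// d'd ?ltnS.
rewrite !mulrA vF00 -(mulrA _ _ (star v)) F00v !mulrA d'n.
by rewrite -(mulrA (F p 0%N) U) -(mulrA (F p 0%N) (U * _)) (corner_Ut cF).
Qed.

End Theory.
End Corner.

Arguments corner_diag {R A D} n F t d.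
Arguments corner_shift {R D} n F U v.

(** * Passing from one stage to the next *)

Section Refinement.
Context {R : realType} {A : cstarAlgType R}.

(** The three formulas for the connecting map, read in a common algebra [D]. Here [m] is the ratio
    of the two matrix sizes, so the finer system has size [m * n]; the product around [t'] is the
    entry [alpha^(ln)(a)] moved from the corner to position [(ln, ln)]. *)
Record corner_refinement (D : cstarAlgType R) (n m : nat) (alpha : A -> A)
    (F : nat -> nat -> D) (t : A -> D) (U : D)
    (F' : nat -> nat -> D) (t' : A -> D) (U' : D) : Prop := CornerRefinement {
  refineF : forall i j, (i < n)%N -> (j < n)%N ->
    F i j = \sum_(l < m) F' (i + l * n)%N (j + l * n)%N;
  refinet : forall a, t a =
    \sum_(l < m) F' (l * n)%N 0%N * t' (iter (l * n) alpha a) * F' 0%N (l * n)%N;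
  refineU : U = F' (m.-1 * n)%N 0%N * U' +
    \sum_(l < m.-1) F' (l * n)%N (l.+1 * n)%N
}.

Context {D : cstarAlgType R} {n m : nat} {alpha : A -> A}.
Context {F F' : nat -> nat -> D} {t t' : A -> D} {U U' : D}.
Hypotheses (n0 : (0 < n)%N) (m0 : (0 < m)%N)
  (cF : corner_system n (iter n alpha) F t U)
  (cF' : corner_system (m * n) (iter (m * n) alpha) F' t' U')
  (rF : corner_refinement n m alpha F t U F' t' U').

Let index_lt i l : (i < n)%N -> (l < m)%N -> (i + l * n < m * n)%N.
Proof. nia. Qed.

Let index_eq i j l l' : (i < n)%N -> (j < n)%N ->
  (i + l * n == j + l' * n)%N = (i == j) && (l == l').
Proof.
move=> ltin ltjn; apply/eqP/andP => [ijl|[/eqP-> /eqP->]//].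
have ll' : l = l'.
  have := congr1 (fun k => k %/ n)%N ijl.
  by rewrite ![(_ + _ * n)%N]addnC !divnMDl// !divn_small// !addn0.
by move: ijl; rewrite ll' => /addIn ->.
Qed.

Lemma refineFF p i j l : (i < n)%N -> (j < n)%N -> (l < m)%N ->
  F' p (i + l * n)%N * F i j = F' p (j + l * n)%N.
Proof.
move=> ltin ltjn lm; rewrite (refineF rF)// mulr_sumr (bigD1 (Ordinal lm))//=.
rewrite (cornerM cF') ?index_lt// eqxx big1 ?addr0// => k kl.
rewrite (cornerM cF') ?index_lt// index_eq// eqxx /= eq_sym.
by rewrite -val_eqE in kl; rewrite (negbTE kl).
Qed.

Lemma refineFU l : (l < m)%N ->
  F' 0%N (l * n)%N * U = if l.+1 == m then U' else F' 0%N (l.+1 * n)%N.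
Proof.
move=> lm; have index0 k k' : (k * n == k' * n)%N = (k == k').
  by rewrite eqn_pmul2r.
have FM k k' p : (k < m)%N ->
    F' 0%N (k * n)%N * F' (k' * n)%N p = if k == k' then F' 0%N p else 0.
  by move=> km; rewrite (cornerM cF') ?index0// ltn_pmul2r.
rewrite (refineU rF) mulrDr mulrA FM// mulr_sumr.
have [lm1|lm1] := eqVneq l.+1 m.
  rewrite -lm1 eqxx (corner_FU cF') big1 ?addr0// => k _.
  by rewrite (FM l k) ?lm1// gtn_eqF//; have := ltn_ord k; rewrite -lm1.
rewrite (negbTE (_ : l != m.-1)); last by apply: contraNneq lm1 => ->; rewrite prednK.
have ltl : (l < m.-1)%N by lia.
rewrite mul0r add0r (bigD1 (Ordinal ltl))//= FM// eqxx big1 ?addr0// => k kl.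
by rewrite FM// eq_sym; rewrite -val_eqE in kl; rewrite (negbTE kl).
Qed.

(** Fine indices fall into [m] blocks of length [n]. Inside a block [v] advances through the coarse
    units; at its end it acts through [U], which leads to the start of the next block, or to [U']
    after the last one. *)
Lemma refine_shift v : corner_shift n F U v -> corner_shift (m * n) F' U' v.
Proof.
move=> vF.
have F'v j l : (j < n)%N -> (l < m)%N -> F' 0%N (j + l * n)%N * v =
    if (j.+1 == n) && (l.+1 == m) then U' else F' 0%N (j + l * n).+1.
  move=> jn lm; rewrite -(refineFF _ jn jn lm) -mulrA.
  have [jn1|jn1] := eqVneq j.+1 n => /=.
    have -> : F j j * v = F j 0%N * U.
      by rewrite -(corner_shift_wrap n0 cF j vF) -jn1.
    by rewrite mulrA refineFF// add0n refineFU// -addSn jn1 -mulSn.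
  have j1n : (j.+1 < n)%N by lia.
  by rewrite (corner_shift_row n0 cF)// refineFF// addSn.
split=> [q qmn|].
  have ltqm : (q %/ n < m)%N by rewrite ltn_divLR// ltnW.
  have := F'v _ _ (ltn_pmod q n0) ltqm; rewrite addnC -divn_eq => ->.
  case: andP => // -[/eqP qn /eqP qm].
  by move: qmn; rewrite {1}(divn_eq q n) -addnS qn -mulSnr qm ltnn.
have -> : (m * n).-1 = (n.-1 + m.-1 * n)%N by nia.
by rewrite F'v ?prednK// !eqxx.
Qed.

Lemma refine_diag d d' :
  (forall i l, (i < n)%N -> (l < m)%N ->
     d' (i + l * n)%N = iter (l * n) alpha (d i)) ->
  corner_diag n F t d = corner_diag (m * n) F' t' d'.
Proof.
move=> d'd; rewrite /corner_diag.
rewrite -(big_mkord xpredT (fun i => F' i 0%N * t' (d' i) * F' 0%N i)) big_nat_mul.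
rewrite big_mkord; under [RHS]eq_bigr => l _.
  rewrite -{1}[(l * n)%N]add0n mulSn big_addn addnK big_mkord.
  over.
rewrite exchange_big; apply: eq_bigr => i _ /=.
rewrite (refinet rF) mulr_sumr mulr_suml; apply: eq_bigr => l _ /=.
have Fl : F i 0%N * F' (l * n)%N 0%N = F' (i + l * n)%N 0%N.
  apply: (can_inj (@starK R D)); rewrite starM !(corner_star cF') (corner_star cF).
  by rewrite -[(l * n)%N]add0n refineFF.
have Fr : F' 0%N (l * n)%N * F 0%N i = F' 0%N (i + l * n)%N.
  by rewrite -[(l * n)%N in LHS]add0n refineFF.
by rewrite d'd// -Fl -Fr !mulrA.
Qed.

End Refinement.

Lemma connecting_map_refinement (R : realType) (A : cstarAlgType R) (n m : nat)
    (alpha : A -> A) (E E' B B' D : cstarAlgType R)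
    (iota : A -> E) (u : E) (iota' : A -> E') (u' : E')
    (Phi : {rmorphism 'M[E]_n -> B}) (Phi' : {rmorphism 'M[E']_m -> B'})
    (gamma : {starhom B -> B'}) (mu : {starhom B -> D}) (mu' : {starhom B' -> D}) :
  (0 < m)%N -> is_connecting_map alpha iota u iota' u' Phi Phi' gamma ->
  (forall b, mu' (gamma b) = mu b) ->
  corner_refinement n (m %/ n) alpha
    (fun i j => mu (Phi (mx_elem n i j 1)))
    (fun a => mu (Phi (mx_elem n 0%N 0%N (iota a))))
    (mu (Phi (mx_elem n 0%N 0%N u)))
    (fun i j => mu' (Phi' (mx_elem m i j 1)))
    (fun a => mu' (Phi' (mx_elem m 0%N 0%N (iota' a))))
    (mu' (Phi' (mx_elem m 0%N 0%N u'))).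
Proof.
move=> m0 [_ gi gu ge] mug.
have TM (M N : 'M[E']_m) : mu' (Phi' M) * mu' (Phi' N) = mu' (Phi' (M *m N)).
  by rewrite -[M *m N]/(M * N) !rmorphM.
split=> [i j ltin ltjn|a|].
- by rewrite -mug ge// !rmorph_sum.
- rewrite -mug gi !rmorph_sum; apply: eq_bigr => l _ /=.
  by rewrite !TM !mx_elemM// mul1r mulr1.
- rewrite -mug gu !rmorphD !rmorph_sum /=; congr (_ + _).
  by rewrite TM mx_elemM// mul1r.
Qed.

(** * The two homomorphisms *)

Lemma starhom_conj (R : realType) (D : cstarAlgType R) (v : D) : unitary v ->
  exists F : {starhom D -> D}, forall x, F x = v * x * star v.
Proof.
move=> [sv vs]; apply: starhom_build => [x y|c x||x y|x].
- by rewrite mulrDr mulrDl.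
- by rewrite -scalerAr -scalerAl.
- by rewrite mulr1.
- by rewrite -!mulrA (mulrA (star v)) sv mul1r.
- by rewrite !starM starK mulrA.
Qed.

Lemma starhom_iter (R : realType) (A : cstarAlgType R) (f : {starhom A -> A}) i :
  exists F : {starhom A -> A}, F =1 iter i f.
Proof.
elim: i => [|i [F FE]]; first exact: starhom_id.
by have [G GE] := starhom_comp F f; exists G => x; rewrite GE FE.
Qed.

Lemma cfun_eval (R : realType) (X : pcompactType) (A : cstarAlgType R) (x : X) :
  exists F : {starhom Cfun X A -> A}, forall f, F f = f x.
Proof. exact: starhom_build. Qed.

Section OdometerSystem.
Context (R : realType) (A : cstarAlgType R) (alpha : {starhom A -> A}).
Context {n m : nat -> nat}.
Hypotheses (n_gt0 : forall k, (0 < n k)%N) (n_start : n 0%N = 1%N)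
  (n_dvd : forall k, (n k %| n k.+1)%N)
  (m_def : forall i, m i = (n i.+1 %/ n i)%N).
Local Notation X := (odometer_space m).
Local Notation C := (Cfun X A).
Context (sigma0_inv : X -> X).
Hypotheses (sigma0_invK : cancel sigma0_inv (@odometer m)).
Context (sigma : {starhom C -> C}).
Hypothesis sigma_def : forall (f : C) x, sigma f x = alpha (f (sigma0_inv x)).
Local Notation dsum := (digit_sum n).
Implicit Types (x y : X) (f : C).

Let nSm k : n k.+1 = (m k * n k)%N := nS n_dvd m_def k.
Let mk_gt0 k : (0 < m k)%N := m_gt0 n_gt0 n_dvd m_def k.
Let dsum_lt k x : (dsum k x < n k)%N := digit_sum_lt n_gt0 n_start n_dvd m_def k x.

Lemma iter_sigmaE i f x :
  iter i sigma f x = iter i alpha (f (iter i sigma0_inv x)).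
Proof. by elim: i x => //= i IH x; rewrite sigma_def IH -iterSr. Qed.

Lemma digit_sum_iter_inv k i x :
  (dsum k (iter i sigma0_inv x) + i = dsum k x %[mod n k])%N.
Proof.
elim: i => [|i IH]; first by rewrite addn0.
rewrite iterS addnS -addSn -IH -[in RHS](sigma0_invK (iter i sigma0_inv x)).
by apply/eqP; rewrite eqn_modDr; apply/eqP/esym/digit_sum_odometer.
Qed.

Lemma digit_sum_mod k x y : (dsum k x = dsum k y %[mod n k])%N -> dsum k x = dsum k y.
Proof. by rewrite !modn_small. Qed.

(** The hypothesis is [dsum k x - i = dsum k y - j] modulo [n k], written without subtraction. *)
Lemma digit_sum_inv_eq k i j x y : (dsum k x + j = dsum k y + i %[mod n k])%N ->
  dsum k (iter i sigma0_inv x) = dsum k (iter j sigma0_inv y).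
Proof.
move=> xy; apply: digit_sum_mod; apply/eqP; rewrite -(eqn_modDr (i + j)) addnA.
rewrite -modnDml digit_sum_iter_inv modnDml xy.
by rewrite [(i + j)%N]addnC addnA -[X in _ == X]modnDml digit_sum_iter_inv modnDml.
Qed.

Lemma digit_sum_point k : dsum k (point : X) = 0%N.
Proof. by elim: k => //= k ->. Qed.

Definition level k f := forall x y, dsum k x = dsum k y -> f x = f y.

Lemma level_le k l f : (k <= l)%N -> level k f -> level l f.
Proof. by move=> kl fk x y xy; apply/fk/(digit_sum_le n_gt0 n_start n_dvd m_def kl). Qed.

Lemma level_sigma k f : level k f -> level k (sigma f).
Proof.
move=> fk x y xy; rewrite !sigma_def; congr (alpha _); apply: fk.
by apply: (@digit_sum_inv_eq k 1 1); rewrite xy.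
Qed.

Lemma level_continuous k (g : X -> A) :
  (forall x y, dsum k x = dsum k y -> g x = g y) -> cnorm_continuous g.
Proof.
move=> gk x e e0; have := near_digit_sum n k x; apply: filterS => y /= yx.
by rewrite (gk y x yx) subrr cnorm0.
Qed.

Lemma level_dense : cnorm_dense [set f : C | exists k, level k f].
Proof.
move=> f e e0.
have [k kP] := cfun_uniform n_gt0 n_start n_dvd m_def f (divr_gt0 e0 (ltr0Sn _ 1)).
(* Going back [n k - dsum k x] steps from the zero sequence gives digit sum [dsum k x] modulo [n k]:
   a representative of the cylinder of [x], chosen from its digit sum alone. *)
pose rep x := iter (n k - dsum k x) sigma0_inv point.
have repE x : dsum k (rep x) = dsum k x.
  apply: (@digit_sum_inv_eq k _ 0); rewrite addn0 digit_sum_point.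
  by rewrite subnKC ?modnn ?mod0n// ltnW.
have gk x y : dsum k x = dsum k y -> f (rep x) = f (rep y).
  by rewrite /rep => ->.
exists (MkCfun (level_continuous gk)); first by exists k.
apply: (@le_lt_trans _ _ (e / 2)); last by rewrite ltr_pdivrMr// ltr_pMr// ltr1n.
by apply: cfun_norm_le => x; exact: ltW (kP _ _ (esym (repE x))).
Qed.

(** * The covariant representation of C(X, A) on a tower of corner systems *)

Section Tower.
Context {D : cstarAlgType R}.
Context {F : nat -> nat -> nat -> D} {t : nat -> A -> D} {U : nat -> D}.
Hypotheses
  (cF : forall k, corner_system (n k) (iter (n k) alpha) (F k) (t k) (U k))
  (rF : forall k, corner_refinement (n k) (m k) alpha
    (F k) (t k) (U k) (F k.+1) (t k.+1) (U k.+1)).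

Definition sample_diag k f :=
  corner_diag (n k) (F k) (t k) (fun i => iter i sigma f point).

(** Moving back by [l * n k] steps does not change the first [k] digits. So entry [i + l * n k] is
    [alpha^(l n_k)] of entry [i], exactly the pattern that a refined diagonal has. *)
Lemma sample_diagS k f : level k f -> sample_diag k.+1 f = sample_diag k f.
Proof.
move=> fk; apply/esym; rewrite /sample_diag nSm.
have cF1 := cF k.+1; rewrite nSm in cF1.
apply: (refine_diag (n_gt0 k) (mk_gt0 k) (cF k) cF1 (rF k)) => i l ltin lm.
rewrite !iter_sigmaE -iterD [(l * _ + i)%N]addnC; congr (iter _ _ _).
by apply/fk/digit_sum_inv_eq; rewrite [in RHS]addnA [in RHS]addnC modnMDl.
Qed.

Lemma sample_diag_stable k l f : (k <= l)%N -> level k f ->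
  sample_diag l f = sample_diag k f.
Proof.
move=> /subnKC <- fk; elim: (l - k)%N => [|p IH]; first by rewrite addn0.
by rewrite addnS sample_diagS ?IH//; apply: level_le fk; rewrite leq_addr.
Qed.

Lemma sample_diag_starhom k :
  exists pi : {starhom C -> D}, forall f, pi f = sample_diag k f.
Proof.
have [d dE] : exists d : nat -> {starhom C -> A},
    forall i f, d i f = iter i sigma f point.
  suff /choice[d dE] : forall i, exists d : {starhom C -> A},
      forall f, d f = iter i sigma f point by exists d.
  move=> i; have [s sE] := starhom_iter sigma i.
  have [ev evE] := @cfun_eval R (X : pcompactType) A point.
  by have [d dE] := starhom_comp s ev; exists d => f; rewrite dE evE sE.
have [pi piE] := corner_diag_starhom (n_gt0 k) (cF k) d.
exists pi => f; rewrite piE; apply: eq_corner_diag => i _; exact: dE.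
Qed.

(** On a function of level [k] the sequence is constant from [k] on; density of such functions and
    the uniform bound 2 make it Cauchy on every [f]. *)
Lemma sample_diag_lim : exists pi : {starhom C -> D},
  forall k f, level k f -> pi f = sample_diag k f.
Proof.
have /choice[p pE] := sample_diag_starhom.
have [|pi piP] := @starhom_lim R C D p.
  move=> f; have [|l lP] := @cnorm_complete R D (fun k => p k f); last by exists l; apply/ccvgP.
  move=> e e0; have [g [k gk] fg] := level_dense f (divr_gt0 e0 (ltr0Sn _ 3)).
  exists k => i j ki kj.
  have pg l : (k <= l)%N -> p l g = p k g.
    by move=> kl; rewrite !pE (sample_diag_stable kl gk).
  have -> : p i f - p j f = p i (f - g) - p j (f - g).
    by rewrite !rmorphB /= !pg// opprB subrKA.
  rewrite (le_lt_trans (cnormD _ _))// cnormN.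
  have := starhom_bound (p i) (f - g); have := starhom_bound (p j) (f - g).
  by move: fg; lra.
exists pi => k f fk; apply: ccvg_unique (piP f) _.
by apply: (@ccvg_near_cst _ _ _ _ k) => l kl; rewrite pE (sample_diag_stable kl fk).
Qed.

Lemma tower_unitary : unitary (U 0%N).
Proof.
have F1 : F 0%N 0%N 0%N = 1.
  by have := corner_sum (cF 0%N); rewrite n_start big_ord1.
by split; rewrite ?(corner_sUU (cF 0%N)) ?(corner_UU (cF 0%N)).
Qed.

Lemma tower_shift k : corner_shift (n k) (F k) (U k) (U 0%N).
Proof.
elim: k => [|k IH]; first by rewrite n_start; split=> //; exact: corner_FU (cF 0%N).
have cF1 := cF k.+1; rewrite nSm in cF1 *.
exact: (refine_shift (n_gt0 k) (mk_gt0 k) (cF k) cF1 (rF k)).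
Qed.

Lemma tower_covariant : exists2 pi : {starhom C -> D},
  covariant sigma pi (U 0%N) & forall k f, level k f -> pi f = sample_diag k f.
Proof.
have [pi piE] := sample_diag_lim; exists pi => //; split; first exact: tower_unitary.
have [c cE] := starhom_conj tower_unitary.
have [cpi cpiE] := starhom_comp pi c; have [spi spiE] := starhom_comp sigma pi.
suff H : cpi =1 spi by move=> f; rewrite -cE -cpiE H spiE.
apply: starhom_eq_dense level_dense _ => f [k fk].
rewrite cpiE spiE cE (piE _ _ fk) (piE _ _ (level_sigma fk)).
apply: (corner_shift_conj (n_gt0 k) (cF k) tower_unitary (tower_shift k)).
  by move=> i _; rewrite iterSr.
(* The wrapped entry is right because [n k] backward steps fix the first [k] digits of [point],
   which leaves [alpha^(n k)] of the entry 0. *)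
rewrite -iterSr prednK// iter_sigmaE; congr (iter _ _ _); apply: fk.
by apply: (@digit_sum_inv_eq k (n k) 0); rewrite addn0 modnDr.
Qed.

End Tower.

Lemma residue_continuous k i :
  cnorm_continuous (fun x => (n k %| dsum k x + i)%:R : A).
Proof. by apply: (@level_continuous k) => x y ->. Qed.

(** The indicator of the cylinder with digit sum [-i] modulo [n k]. [residue k 0] is [p k], and
    [residue k i] is its translate under the [i]-th inverse power of [sigma]. *)
Definition residue k i : C := MkCfun (residue_continuous k i).

Lemma level_residue_cst k i a : level k (residue k i * cfun_cst a).
Proof. by move=> x y xy; rewrite /= xy. Qed.

Lemma residueC k i f : residue k i * f = f * residue k i.
Proof. by apply: cfunE => x /=; rewrite mulr_natl mulr_natr. Qed.

Lemma residueS k i : sigma (residue k i.+1) = residue k i.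
Proof.
apply: cfunE => x; rewrite sigma_def /= rmorph_nat; congr (nat_of_bool _)%:R.
have := digit_sum_iter_inv k 1 x; rewrite addn1 /= => dx.
by rewrite addnS -addSn /dvdn -modnDml dx modnDml.
Qed.

Lemma iter_residue k i f :
  iter i sigma (f * residue k i) = iter i sigma f * residue k 0.
Proof.
elim: i f => [//|i IH] f.
by rewrite iterSr rmorphM /= residueS IH -iterSr.
Qed.

Lemma iter_residue1 k i : iter i sigma (residue k i) = residue k 0.
Proof. by elim: i => [//|i IH]; rewrite iterSr residueS. Qed.

Lemma residueMM k i j : (i < n k)%N -> (j < n k)%N ->
  residue k i * residue k j = if i == j then residue k i else 0.
Proof.
move=> ltin ltjn; apply: cfunE => x /=; rewrite -natrM mulnb.
have [<-|ij] := eqVneq i j; first by rewrite andbb.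
case: andP => // -[] /eqP xi /eqP xj; case/eqP: ij.
have : (dsum k x + i == dsum k x + j %[mod n k])%N by rewrite xi xj.
by rewrite eqn_modDl !modn_small// => /eqP.
Qed.

Lemma cfun_sumE (I : Type) (r : seq I) (G : I -> C) x :
  (\sum_(i <- r) G i) x = \sum_(i <- r) G i x.
Proof. by elim/big_rec2: _ => // i y f _ <-. Qed.

Lemma sum_residue k : \sum_(i < n k) residue k i = 1.
Proof.
apply: cfunE => x; rewrite cfun_sumE /=.
have lti : ((n k - dsum k x) %% n k < n k)%N by rewrite ltn_pmod.
have xi : (n k %| dsum k x + (n k - dsum k x) %% n k)%N.
  by rewrite /dvdn modnDmr subnKC ?modnn// ltnW.
rewrite (bigD1 (Ordinal lti))//= xi big1 ?addr0// => j.
rewrite -val_eqE /= => /eqP ji; case: (boolP (n k %| _)%N) => // /eqP xj.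
case: ji; rewrite -(modn_small (ltn_ord j)) -(modn_small lti).
by apply/eqP; rewrite -(eqn_modDl (dsum k x)) xj; move/eqP: xi => ->.
Qed.

Lemma sum_residueS k :
  \sum_(l < m k) residue k.+1 (l * n k) = residue k 0.
Proof.
apply: cfunE => x; rewrite cfun_sumE /= addn0.
set d := dsum k x.
have dvd_l l : (n k.+1 %| d + x k * n k + l * n k)%N -> (n k %| d)%N.
  move=> /(dvdn_trans (n_dvd k)).
  by rewrite -addnA -mulnDl dvdn_addl// dvdn_mull.
have [nd|nd] := boolP (n k %| d)%N; last first.
  by apply: big1 => l _; case: (boolP (_ %| _)%N) => // /dvd_l; rewrite (negbTE nd).
have d0 : d = 0%N by move: nd; rewrite /dvdn modn_small ?dsum_lt// => /eqP.
have lt_xm : (x k < m k)%N by exact: digit_lt n_gt0 n_dvd m_def x k.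
(* When the first [k] digits vanish, digit [k] selects the one nonzero summand, [l = - x k] modulo
   [m k]. *)
have lti : ((m k - x k) %% m k < m k)%N by rewrite ltn_pmod.
have dvdE l : (n k.+1 %| d + x k * n k + l * n k)%N = (m k %| x k + l)%N.
  by rewrite d0 add0n -mulnDl nSm dvdn_pmul2r.
have xi : (m k %| x k + (m k - x k) %% m k)%N.
  by rewrite /dvdn modnDmr subnKC ?modnn// ltnW.
rewrite (bigD1 (Ordinal lti))//= dvdE xi big1 ?addr0// => j.
rewrite -val_eqE /= dvdE => /eqP ji; case: (boolP (m k %| _)%N) => // /eqP xj.
case: ji; rewrite -(modn_small (ltn_ord j)) -(modn_small lti).
by apply/eqP; rewrite -(eqn_modDl (x k)) xj; move/eqP: xi => ->.
Qed.

Lemma sigma_cst i a : iter i sigma (cfun_cst a) = cfun_cst (iter i alpha a).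
Proof. by apply: cfunE => x; rewrite iter_sigmaE. Qed.

(* Freezing [f] at [point] after [i] steps of [sigma] loses nothing on the
   support of [residue k 0]. *)
Lemma level_iter_residue k i f : level k f ->
  iter i sigma (f * residue k i) = cfun_cst (iter i sigma f point) * residue k 0.
Proof.
move=> fk; rewrite iter_residue; apply: cfunE => x /=.
rewrite addn0; case: (boolP (n k %| _)%N) => [/eqP x0|]; last by rewrite !mulr0.
congr (_ * _); rewrite !iter_sigmaE; congr (iter _ _ _).
by apply/fk/digit_sum_inv_eq; rewrite digit_sum_point -modnDml x0.
Qed.

(** * Matrix units in the crossed product and maps from the stages into it *)

Section CrossedProduct.
Context {P : cstarAlgType R} {iota : {starhom C -> P}} {u : P}.
Hypothesis cov : covariant sigma iota u.
Let suX j : star u ^+ j * u ^+ j = 1.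
Proof. by rewrite -starX; case: (unitaryX j cov.1). Qed.
Let usX j : u ^+ j * star u ^+ j = 1.
Proof. by rewrite -starX; case: (unitaryX j cov.1). Qed.

Lemma covariant_iter i f : u ^+ i * iota f * star u ^+ i = iota (iter i sigma f).
Proof.
elim: i => [|i IH]; first by rewrite !expr0 mul1r mulr1.
by rewrite iterS -cov.2 -IH exprS exprSr !mulrA.
Qed.

Lemma covariant_iter_inv i f : star u ^+ i * iota (iter i sigma f) * u ^+ i = iota f.
Proof. by rewrite -covariant_iter !mulrA suX mul1r -mulrA suX mulr1. Qed.

Definition level_unit k i j := star u ^+ i * iota (residue k 0) * u ^+ j.

(** With the projection moved to the right end here, and to the left end in the next lemma, the
    projections of two multiplied units become adjacent and [residueMM] applies. *)
Lemma level_unitE k i j : level_unit k i j = star u ^+ i * u ^+ j * iota (residue k j).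
Proof.
rewrite /level_unit -(covariant_iter_inv j (residue k j)).
by rewrite iter_residue1 !mulrA -(mulrA _ (u ^+ j)) usX mulr1.
Qed.

Lemma level_unitEr k i j : level_unit k i j = iota (residue k i) * (star u ^+ i * u ^+ j).
Proof.
rewrite /level_unit -(covariant_iter_inv i (residue k i)) iter_residue1.
by rewrite -!mulrA [u ^+ i * _]mulrA usX mul1r.
Qed.

Lemma level_unitM k i j p q : (j < n k)%N -> (p < n k)%N ->
  level_unit k i j * level_unit k p q = if j == p then level_unit k i q else 0.
Proof.
move=> jn pn; rewrite level_unitE level_unitEr mulrA -(mulrA _ (iota _) (iota _)).
rewrite -rmorphM residueMM//; case: eqP => [<-|_]; last first.
  by rewrite raddf0 mulr0 mul0r.
rewrite -(mulrA _ (iota _)) -level_unitEr /level_unit !mulrA.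
by rewrite -(mulrA _ (u ^+ j)) usX mulr1.
Qed.

Lemma level_unit_star k i j : star (level_unit k i j) = level_unit k j i.
Proof.
rewrite /level_unit !starM starX starX starK -starhom_star mulrA.
congr (_ * iota _ * _); apply: cfunE => x /=.
by case: (_ %| _)%N; rewrite ?star1 ?star0.
Qed.

Lemma level_unit_diag k i : level_unit k i i = iota (residue k i).
Proof. by rewrite level_unitE suX mul1r. Qed.

Lemma level_unit_sum k : \sum_(i < n k) level_unit k i i = 1.
Proof.
rewrite -(rmorph1 iota) -(sum_residue k) rmorph_sum; apply: eq_bigr => i _.
exact: level_unit_diag.
Qed.

Lemma cfun_cst_starhom : exists F : {starhom A -> C}, F =1 @cfun_cst R X A.
Proof. by apply: starhom_build => *; apply: cfunE. Qed.

Lemma crossed_product_power k (E : cstarAlgType R) (i : {starhom A -> E}) (w : E) :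
  is_crossed_product (iter (n k) alpha) i w ->
  exists2 phi : {starhom E -> P}, (forall a, phi (i a) = iota (cfun_cst a)) &
    phi w = u ^+ n k.
Proof.
move=> [_ _ univ]; have [c cE] := cfun_cst_starhom.
have [pi piE] := starhom_comp c iota.
have [|phi phii phiw] := univ P pi (u ^+ n k).
  split; first exact: unitaryX cov.1.
  by move=> a; rewrite !piE !cE starX covariant_iter sigma_cst.
by exists phi => // a; rewrite phii piE cE.
Qed.

Lemma residue_cst_comm k a :
  iota (cfun_cst a) * iota (residue k 0) = iota (residue k 0) * iota (cfun_cst a).
Proof. by rewrite -!rmorphM residueC. Qed.

Lemma residue_power_comm k :
  u ^+ n k * iota (residue k 0) = iota (residue k 0) * u ^+ n k.
Proof.
have pk : iter (n k) sigma (residue k 0) = residue k 0.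
  rewrite -[RHS](iter_residue1 k (n k)); congr (iter _ _ _).
  by apply: cfunE => x /=; rewrite addn0 /dvdn modnDr.
by rewrite -{2}pk -covariant_iter -[RHS]mulrA suX mulr1.
Qed.

(** Generators are prescribed in every matrix position because the connecting map puts those of the
    next stage outside the corner. *)
Definition level_rep k (E B : cstarAlgType R) (i : A -> E) (w : E)
    (Phi : 'M[E]_(n k) -> B) (nu : B -> P) :=
  forall p q, (p < n k)%N -> (q < n k)%N ->
    (forall a, nu (Phi (mx_elem (n k) p q (i a))) =
       star u ^+ p * iota (residue k 0 * cfun_cst a) * u ^+ q) /\
    nu (Phi (mx_elem (n k) p q w)) =
      star u ^+ p * iota (residue k 0) * u ^+ (n k + q).

Lemma level_rep1 k (E B : cstarAlgType R) (i : {starhom A -> E}) (w : E)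
    (Phi : 'M[E]_(n k) -> B) (nu : B -> P) p q :
  level_rep i w Phi nu -> (p < n k)%N -> (q < n k)%N ->
  nu (Phi (mx_elem (n k) p q 1)) = level_unit k p q.
Proof.
move=> nuE pn qn; rewrite -(rmorph1 i) (nuE p q pn qn).1 /level_unit.
by congr (_ * iota _ * _); apply: cfunE => x /=; rewrite mulr1.
Qed.

Lemma level_rep_exists k (E B : cstarAlgType R) (i : {starhom A -> E}) (w : E)
    (Phi : {rmorphism 'M[E]_(n k) -> B}) :
  is_crossed_product (iter (n k) alpha) i w -> is_matrix_algebra Phi ->
  exists nu : {starhom B -> P}, level_rep i w Phi nu.
Proof.
move=> cp PhiM; have [phi phii phiw] := crossed_product_power cp.
have phip (x : E) : phi x * iota (residue k 0) = iota (residue k 0) * phi x.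
  case: cp => _ gen _; apply: (starhom_comm_generated gen).
  - by rewrite -level_unit_diag level_unit_star.
  - by move=> a; rewrite phii residue_cst_comm.
  - by rewrite phiw residue_power_comm.
have [||||nu nuE] := @matrix_algebra_starhom R (n k) E B P Phi phi (level_unit k) PhiM (n_gt0 k).
- by move=> *; exact: level_unitM.
- by move=> *; exact: level_unit_star.
- exact: level_unit_sum.
- by move=> x; rewrite level_unit_diag.
have {}nuE p q (x : E) : (p < n k)%N -> (q < n k)%N ->
    nu (Phi (mx_elem (n k) p q x)) = star u ^+ p * iota (residue k 0) * phi x * u ^+ q.
  move=> pn qn; rewrite nuE// /level_unit !expr0 mulr1 mul1r.
  rewrite !mulrA -(mulrA _ (phi x)) phip mulrA -(mulrA _ (iota _) (iota _)).
  by rewrite -rmorphM residueMM// eqxx.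
exists nu => p q pn qn; split=> [a|].
  by rewrite nuE// phii rmorphM mulrA.
by rewrite nuE// phiw exprD !mulrA.
Qed.

Lemma level_rep_compat k (E E' B B' : cstarAlgType R)
    (i : {starhom A -> E}) (w : E) (i' : {starhom A -> E'}) (w' : E')
    (Phi : {rmorphism 'M[E]_(n k) -> B}) (Phi' : {rmorphism 'M[E']_(n k.+1) -> B'})
    (gamma : {starhom B -> B'}) (nu : {starhom B -> P}) (nu' : {starhom B' -> P}) :
  is_crossed_product (iter (n k) alpha) i w -> is_matrix_algebra Phi ->
  is_connecting_map alpha i w i' w' Phi Phi' gamma ->
  level_rep i w Phi nu -> level_rep i' w' Phi' nu' ->
  forall b, nu' (gamma b) = nu b.
Proof.
move=> [_ gen _] PhiM [_ gi gw ge] nuE nuE'.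
rewrite -m_def in gi gw ge.
have lt_l l p : (p < n k)%N -> (l < m k)%N -> (p + l * n k < n k.+1)%N.
  by rewrite nSm; nia.
have lt_l0 l : (l < m k)%N -> (l * n k < n k.+1)%N.
  by move=> lm; rewrite -[(l * _)%N]add0n lt_l.
have sum_p : \sum_(l < m k) star u ^+ (l * n k) * iota (residue k.+1 0) * u ^+ (l * n k) =
    iota (residue k 0).
  rewrite -(sum_residueS k) rmorph_sum; apply: eq_bigr => l _.
  exact: level_unit_diag.
have [gnu gnuE] := starhom_comp gamma nu'.
suff gnu_nu : gnu =1 nu by move=> b; rewrite -gnuE gnu_nu.
apply: (matrix_algebra_starhom_eq gen PhiM (n_gt0 k)).
- move=> a; rewrite gnuE gi !rmorph_sum (nuE 0%N 0%N _ _).1// expr0 mul1r mulr1.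
  rewrite -(sum_residueS k) mulr_suml rmorph_sum; apply: eq_bigr => l _ /=.
  rewrite (nuE' _ _ _ _).1 ?lt_l0// -[RHS](covariant_iter_inv (l * n k)).
  by rewrite [in RHS]residueC iter_residue sigma_cst -residueC.
- rewrite gnuE gw !rmorphD !rmorph_sum (nuE 0%N 0%N _ _).2//= expr0 mul1r addn0.
  (* [p k] times [u^(n k)] is expanded over the subcylinders of level [k.+1]: the last term contains
     [u^(n k.+1)] and matches the generator, the others are the units from block [l] to block
     [l.+1]. *)
  rewrite -sum_p mulr_suml -[in RHS](prednK (mk_gt0 k)) big_ord_recr /= addrC.
  congr (_ + _); last first.
    apply: eq_bigr => l _; rewrite (level_rep1 nuE') ?lt_l0//; last 2 first.
    - by rewrite (leq_trans (ltn_ord l))// leq_pred.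
    - by have := ltn_ord l; lia.
    by rewrite /level_unit mulSnr exprD mulrA.
  rewrite (nuE' _ _ _ _).2 ?lt_l0// ?prednK// addn0 -!mulrA -exprD.
  by rewrite -mulSnr prednK// -nSm.
- move=> p q pn qn; rewrite gnuE ge// !rmorph_sum (level_rep1 nuE)// /level_unit.
  rewrite -sum_p mulr_sumr mulr_suml; apply: eq_bigr => l _ /=.
  rewrite (level_rep1 nuE') ?lt_l// /level_unit exprD [(q + _)%N]addnC exprD.
  by rewrite !mulrA.
Qed.
End CrossedProduct.

Lemma bunce_deddens_crossed_product (BD P : cstarAlgType R)
    (iota : {starhom C -> P}) (u : P) :
  is_bunce_deddens alpha n BD -> is_crossed_product sigma iota u ->
  star_isomorphic BD P.
Proof.
move=> [E [io [w [B [Phi [gamma [mu [cp PhiM conn [mug lim]]]]]]]]] [cov gen univ].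
have nuP k : exists nu : {starhom B k -> P},
    level_rep (iota := iota) (u := u) (io k) (w k) (Phi k) nu.
  exact: (level_rep_exists cov (cp k) (PhiM k)).
pose nu k := sval (cid (nuP k)).
have nuE k : level_rep (iota := iota) (u := u) (io k) (w k) (Phi k) (nu k).
  exact: (svalP (cid (nuP k))).
move: nu nuE => nu nuE.
have nug k b : nu k.+1 (gamma k b) = nu k b.
  exact: (level_rep_compat cov (cp k) (PhiM k) (conn k) (nuE k) (nuE k.+1) b).
have [psi [psiE _]] := lim P nu nug.
pose F k i j := mu k (Phi k (mx_elem (n k) i j 1)).
pose t k a := mu k (Phi k (mx_elem (n k) 0%N 0%N (io k a))).
pose U k := mu k (Phi k (mx_elem (n k) 0%N 0%N (w k))).
have cF k : corner_system (n k) (iter (n k) alpha) (F k) (t k) (U k).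
  by apply: matrix_corner_system (PhiM k) => //; case: (cp k).
have rF k : corner_refinement (n k) (m k) alpha (F k) (t k) (U k)
    (F k.+1) (t k.+1) (U k.+1).
  by rewrite m_def; exact: connecting_map_refinement (conn k) (mug k).
have [pi covpi piE] := tower_covariant cF rF.
have [phi phii phiu] := univ BD pi (U 0%N) covpi.
have [psiphi psiphiE] := starhom_comp phi psi.
have [phipsi phipsiE] := starhom_comp psi phi.
have psi_t k a : psi (t k a) = iota (residue k 0 * cfun_cst a).
  by rewrite psiE (nuE k 0%N 0%N _ _).1// expr0 mul1r mulr1.
have psi_F k i j : (i < n k)%N -> (j < n k)%N ->
    psi (F k i j) = level_unit (iota := iota) (u := u) k i j.
  by move=> ltin ltjn; rewrite psiE (level_rep1 (nuE k)).
have psi_pi f : psi (pi f) = iota f.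
  have [pipsi pipsiE] := starhom_comp pi psi.
  rewrite -pipsiE; apply: starhom_eq_dense level_dense _ f => f [k fk].
  rewrite pipsiE (piE _ _ fk) /sample_diag /corner_diag rmorph_sum.
  (* Inserting the partition of unity cuts [f] into pieces [f * residue k i], each a translate of a
     constant times [residue k 0]; these match the diagonal entries one by one. *)
  rewrite -[in RHS](mulr1 f) -(sum_residue k) mulr_sumr rmorph_sum.
  apply: eq_bigr => i _; rewrite [LHS]rmorphM [X in X * _]rmorphM /= psi_t !psi_F//.
  rewrite -[in RHS](covariant_iter_inv cov i) (level_iter_residue _ fk).
  set c := cfun_cst _; rewrite /level_unit expr0 mulr1 mul1r.
  have <- : iota (residue k 0) * iota (residue k 0 * c) * iota (residue k 0) =
      iota (c * residue k 0).
    rewrite -!rmorphM -(residueC k 0 (_ * (_ * c))) !mulrA.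
    have pp : residue k 0 * residue k 0 = residue k 0 :> C by rewrite residueMM.
    by rewrite !pp residueC.
  by rewrite !mulrA.
have psi_phi : psiphi =1 id.
  have [idP idPE] := starhom_id P.
  move=> x; rewrite -[RHS]idPE; apply: starhom_eq_generated gen _ _ x => [f|].
    by rewrite psiphiE idPE phii psi_pi.
  rewrite psiphiE idPE phiu psiE (nuE 0%N 0%N 0%N _ _).2//.
  rewrite expr0 mul1r n_start expr1 (_ : residue 0 0 = 1) ?rmorph1 ?mul1r//.
  by apply: cfunE => x0; rewrite /= n_start dvd1n.
(* Only entry 0 of the sampled diagonal is nonzero: for [0 < i < n k], going back [i] steps from
   [point] leaves the cylinder of zeros. *)
have pi_residue k a : pi (residue k 0 * cfun_cst a) = t k a.
  rewrite (piE k); last exact: level_residue_cst.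
  rewrite /sample_diag /corner_diag (bigD1 (Ordinal (n_gt0 k)))//= addn0.
  rewrite digit_sum_point dvdn0 mul1r big1 ?addr0 => [|i].
    by rewrite (corner_Ft (cF k)) (corner_tF (cF k)).
  rewrite -val_eqE /= => i0; rewrite iter_sigmaE /= addn0.
  case: (boolP (_ %| _)%N) => [/eqP zi|_]; last first.
    have [s sE] := starhom_iter alpha i.
    by rewrite mul0r -sE raddf0 (corner_t0 (cF k)) mulr0 mul0r.
  have := digit_sum_iter_inv k i point.
  rewrite digit_sum_point -modnDml zi add0n mod0n modn_small// => /eqP.
  by rewrite (negbTE i0).
have pi_F k i j : (i < n k)%N -> (j < n k)%N ->
    phi (level_unit (iota := iota) (u := u) k i j) = F k i j.
  move=> ltin ltjn; rewrite /level_unit !rmorphM !rmorphXn /= starhom_star phii phiu.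
  have -> : residue k 0 = residue k 0 * cfun_cst 1 :> C.
    by apply: cfunE => x /=; rewrite mulr1.
  rewrite pi_residue /t rmorph1 -/(F k 0%N 0%N).
  (* Doubling the projection gives each power of [v] its own copy: the right one yields [F k 0 j],
     the left one, after [star], [F k i 0]. *)
  have -> : F k 0%N 0%N = F k 0%N 0%N * F k 0%N 0%N by rewrite (cornerM (cF k)).
  rewrite -starX -{1}(corner_star (cF k) 0%N 0%N) mulrA -starM -mulrA.
  have shift := tower_shift cF rF k.
  by rewrite !(corner_shiftX shift)// (corner_star (cF k)) (cornerM (cF k)).
have phi_nu k b : phi (nu k b) = mu k b.
  have [nuphi nuphiE] := starhom_comp (nu k) phi.
  have [_ genk _] := cp k.
  rewrite -nuphiE; apply: (matrix_algebra_starhom_eq genk (PhiM k) (n_gt0 k)).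
  - move=> a; rewrite nuphiE (nuE k 0%N 0%N _ _).1// expr0 mul1r mulr1.
    by rewrite phii pi_residue.
  - rewrite nuphiE (nuE k 0%N 0%N _ _).2// expr0 mul1r addn0.
    rewrite rmorphM rmorphXn /= phiu -(level_unit_diag cov) pi_F//.
    exact: (corner_shiftXn (n_gt0 k) (tower_shift cF rF k)).
  - by move=> i j ltin ltjn; rewrite nuphiE (level_rep1 (nuE k))// pi_F.
have phi_psi : phipsi =1 id.
  have [idB idBE] := starhom_id BD.
  (* The identity and [phi] after [psi] both factor the cone [mu], so uniqueness in the limit
     identifies them. *)
  have [chi [_ chiE]] := lim BD mu mug.
  move=> x; rewrite -[RHS]idBE (chiE phipsi) ?(chiE idB)// => k b.
    by rewrite phipsiE psiE phi_nu.
exists psi; exists phi => x; first by rewrite -phipsiE phi_psi.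
by rewrite -psiphiE psi_phi.
Qed.
End OdometerSystem.

(* [n k] is the paper's n_{k+1} and [m i] its m_{i+1}. *)
Theorem theorem3p4 (R : realType) (A : cstarAlgType R)
  (A_separable : cseparable A)
  (alpha : {starhom A -> A}) (alpha_bij : bijective alpha)
  (n : nat -> nat)
  (n_gt0 : forall k : nat, (0 < n k)%N)
  (n_increasing : forall k : nat, (n k < n k.+1)%N)
  (n_dvd : forall k : nat, (n k %| n k.+1)%N)
  (n_start : n 0%N = 1%N)
  (m : nat -> nat) (m_def : forall i : nat, m i = (n i.+1 %/ n i)%N)
  (sigma0_inv : odometer_space m -> odometer_space m)
  (sigma0K : cancel (@odometer m) sigma0_inv)
  (sigma0_invK : cancel sigma0_inv (@odometer m))
  (sigma : {starhom Cfun (odometer_space m) A -> Cfun (odometer_space m) A})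
  (sigma_def : forall (f : Cfun (odometer_space m) A) (x : odometer_space m),
     sigma f x = alpha (f (sigma0_inv x)))
  (BD : cstarAlgType R) (BD_def : is_bunce_deddens alpha n BD)
  (P : cstarAlgType R)
  (iota : {starhom Cfun (odometer_space m) A -> P}) (u : P)
  (P_def : is_crossed_product sigma iota u) :
  star_isomorphic BD P.
Proof. exact: bunce_deddens_crossed_product BD_def P_def. Qed.
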